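(* For every rational $k\in\{2\}\cup[2.5,3)$ we have $$g(k,6)=\tfrac12\Bigl(\sqrt{k^2+4}-k\Bigr).$$
   Context: A fractional $m$-coloring of a graph $G$ (for a real $m>0$) is an assignment of a measurable subset of $[0,m)\subseteq\mathbb R$ of Lebesgue measure one to each vertex such that adjacent vertices receive disjoint sets. $G$ is fractionally $k$-colorable if it has a fractional $k$-coloring. A fractional $m$-precoloring of a vertex set $W$ is an assignment of measurable subsets of $[0,m)$ of measure one to the vertices of $W$; it extends to $G$ if there is a fractional $m$-coloring of $G$ agreeing with it on $W$. For a rational $k\ge 2$ and an integer $d\ge 3$, $g(k,d)$ is the infimum of the set of non-negative reals $\varepsilon$ such that for every $\varepsilon'\ge\varepsilon$, every fractionally $k$-colorable (finite) graph $G$ and every set $W\subseteq V(G)$ of vertices at pairwise distance at least $d$, every fractional $(k+\varepsilon')$-precoloring of $W$ extends to a fractional $(k+\varepsilon')$-coloring of $G$. *)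

(* Defs.v *)
From Stdlib Require Import Reals Lra.
Open Scope R_scope.

Definition RSet := R -> Prop.

Definition outer_le (A : RSet) (r : R) : Prop :=
  forall eps, 0 < eps ->
    exists a b : nat -> R,
      (forall n, a n <= b n) /\
      (forall x, A x -> exists n, a n < x < b n) /\
      exists s, infinite_sum (fun n => b n - a n) s /\ s <= r + eps.

Definition outer_eq (A : RSet) (r : R) : Prop :=
  outer_le A r /\ forall r', outer_le A r' -> r <= r'.

(* Caratheodory (Lebesgue) measurability: for every test set E with finite
   outer measure <= r, mu*(E /\ A) + mu*(E \ A) <= r.  (The reverse
   inequality always holds by subadditivity.) *)
Definition lebesgue_measurable (A : RSet) : Prop :=
  forall (E : RSet) (r : R), outer_le E r ->
    exists r1 r2, outer_le (fun x => E x /\ A x) r1 /\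
                  outer_le (fun x => E x /\ ~ A x) r2 /\ r1 + r2 <= r.

Definition unit_color_set (m : R) (A : RSet) : Prop :=
  (forall x, A x -> 0 <= x < m) /\ lebesgue_measurable A /\ outer_eq A 1.

Definition simple_graph (n : nat) (adj : nat -> nat -> Prop) : Prop :=
  (forall u v, adj u v -> (u < n)%nat /\ (v < n)%nat) /\
  (forall u v, adj u v -> adj v u) /\
  (forall u, ~ adj u u).

Definition frac_coloring (n : nat) (adj : nat -> nat -> Prop) (m : R)
  (c : nat -> RSet) : Prop :=
  (forall v, (v < n)%nat -> unit_color_set m (c v)) /\
  (forall u v, adj u v -> forall x, ~ (c u x /\ c v x)).

Definition frac_colorable (n : nat) (adj : nat -> nat -> Prop) (m : R) : Prop :=
  exists c, frac_coloring n adj m c.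

Inductive walk (adj : nat -> nat -> Prop) : nat -> nat -> nat -> Prop :=
| walk0 : forall u, walk adj u u 0
| walkS : forall u w v l, adj u w -> walk adj w v l -> walk adj u v (S l).

Definition far_apart (adj : nat -> nat -> Prop) (W : nat -> Prop) (d : nat) : Prop :=
  forall u v, W u -> W v -> u <> v -> forall l, (l < d)%nat -> ~ walk adj u v l.

Definition precoloring (m : R) (W : nat -> Prop) (p : nat -> RSet) : Prop :=
  forall w, W w -> unit_color_set m (p w).

Definition extends (n : nat) (adj : nat -> nat -> Prop) (m : R)
  (W : nat -> Prop) (p : nat -> RSet) : Prop :=
  exists c, frac_coloring n adj m c /\ forall w, W w -> forall x, c w x <-> p w x.

Definition ext_property (k : R) (d : nat) (eps : R) : Prop :=
  forall n adj, simple_graph n adj -> frac_colorable n adj k ->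
  forall W : nat -> Prop, (forall w, W w -> (w < n)%nat) -> far_apart adj W d ->
  forall p, precoloring (k + eps) W p -> extends n adj (k + eps) W p.

Definition g_set (k : R) (d : nat) (eps : R) : Prop :=
  0 <= eps /\ forall eps', eps <= eps' -> ext_property k d eps'.

Definition is_glb (S : R -> Prop) (x : R) : Prop :=
  (forall y, S y -> x <= y) /\ (forall z, (forall y, S y -> z <= y) -> z <= x).

Definition g_eq (k : R) (d : nat) (x : R) : Prop := is_glb (g_set k d) x.

Definition is_rational (k : R) : Prop :=
  exists p q : Z, q <> 0%Z /\ k = IZR p / IZR q.

(* Main.v *)
Require Import Defs.
From Stdlib Require Import Reals Lra Lia ClassicalEpsilon Arith List
  FunctionalExtensionality PropExtensionality.
Open Scope R_scope.

(** Put [m = k + eps] and [al = 1 / m]; the claimed value is the positive root of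
[eps * (k + eps) = 1], so the threshold is [al <= eps].

Upper bound.  Choose disjoint sets [Base] of measure [k] and [Star] of measure
[al] in [[0, m)], independent of all precolored sets, and copy a fractional
[k]-coloring into [Base] as [C], independently of the precolored sets.  Vertices
at distance at least 3 from the roots use [C].  A neighbour of a root [w] must
avoid [p w], of density [al]: it uses [C] outside [p w], all of [Star] outside
[p w], and a set [D w] of measure [al ^ 2] taken from [C w] outside [p w] (as
[k < 3], the neighbours of [w] form an independent set, so they can share these
sets).  Vertices at distance 2 give up [D w] and are compensated inside the
intersection of [Star] and [p w], where no neighbour of [w] lives.

Lower bound.  Let [T] be a fractionally [k]-colorable graph with weights of total
[M * k], every independent set having weight at most [M], and with an independent
set [first] of weight exactly [M] whose vertices have a common further neighbour.
Attach many copies of [T], rooted at that neighbour, to common twins [Y] of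
[first].  If the root has color [A], packing independent sets on [A] (with [Y] in
place of [first]) and off [A] gives
[M * k + sum (z a * mu (Y a /\ A)) <= M * m]; averaging over roots whose sets cover
[[0, m)] uniformly yields [k + 1 / m <= m].  For [k = 2] the graph [T] is an edge.
For [k = 2 + r / q] with [1/2 <= r / q < 1] it consists of three copies [v], [s],
[l] of the cyclic group of order [q + r], with weights [q], [r], [r], and of one
vertex of weight [(q - r) * (q + r)]; the vertices of type [v] form [first]. *)

(** * Lebesgue measure *)

Lemma series_below (f : nat -> R) (r : R) :
  (forall n, 0 <= f n) -> (forall N, sum_f_R0 f N <= r) ->
  exists s, infinite_sum f s /\ s <= r.
Proof.
  intros Hf Hr.
  assert (Hg : Un_growing (sum_f_R0 f)).
  { intro N. rewrite tech5. specialize (Hf (S N)). lra. }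
  assert (Hb : has_ub (sum_f_R0 f)).
  { exists r. intros x [N ->]. apply Hr. }
  destruct (growing_cv _ Hg Hb) as [l Hl].
  exists l. split; [exact Hl|].
  destruct (Rle_or_lt l r) as [H|H]; [exact H|].
  destruct (Hl (l - r)) as [N HN]; [lra|].
  specialize (HN N (le_n _)). unfold Rdist in HN.
  specialize (Hr N). rewrite Rabs_left1 in HN; lra.
Qed.

(** Since the terms are nonnegative, bounding the series amounts to bounding its partial sums;
    covers can then be handled without limits. *)
Lemma outer_leE (A : RSet) (r : R) :
  outer_le A r <->
  forall eps, 0 < eps -> exists a b : nat -> R,
    (forall n, a n <= b n) /\ (forall x, A x -> exists n, a n < x < b n) /\
    forall N, sum_f_R0 (fun n => b n - a n) N <= r + eps.
Proof.
  split; intros H eps He; destruct (H eps He) as (a & b & Hab & Hc & Hs);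
    exists a, b; (split; [exact Hab|split; [exact Hc|]]).
  - destruct Hs as (s & Hs & Hle). intro N. apply Rle_trans with s; [|exact Hle].
    apply sum_incr; [exact Hs|]. intro n. specialize (Hab n). lra.
  - apply series_below; [|exact Hs]. intro n. specialize (Hab n). lra.
Qed.

Lemma outer_le_sub (A B : RSet) (r s : R) :
  (forall x, A x -> B x) -> r <= s -> outer_le B r -> outer_le A s.
Proof.
  intros HAB Hrs HB eps He.
  destruct (HB eps He) as (a & b & Hab & Hc & t & Ht & Hle).
  exists a, b. split; [exact Hab|split; [auto|]]. exists t. split; [exact Ht|lra].
Qed.

Lemma outer_le_ge0 (A : RSet) (r : R) : outer_le A r -> 0 <= r.
Proof.
  intro H. destruct (Rle_or_lt 0 r) as [Hr|Hr]; [exact Hr|].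
  destruct (proj1 (outer_leE A r) H (- r / 2)) as (a & b & Hab & _ & Hs); [lra|].
  specialize (Hs O). simpl in Hs. specialize (Hab O). lra.
Qed.

Lemma sum_interleave (f g : nat -> R) (N : nat) :
  sum_f_R0 (fun n => if Nat.even n then f (Nat.div2 n) else g (Nat.div2 n)) (S (2 * N))
  = sum_f_R0 f N + sum_f_R0 g N.
Proof.
  set (h := fun n => _).
  assert (H0 : forall n, h (2 * n)%nat = f n).
  { intro n. unfold h. rewrite Nat.even_mul, Nat.div2_double. reflexivity. }
  assert (H1 : forall n, h (S (2 * n)) = g n).
  { intro n. unfold h. rewrite Nat.even_succ, Nat.odd_mul, Nat.div2_succ_double. reflexivity. }
  induction N as [|N IH].
  - simpl. change (h 0%nat) with (h (2*0)%nat). change (h 1%nat) with (h (S (2*0))).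
    rewrite H0, H1. reflexivity.
  - replace (S (2 * S N)) with (S (S (S (2 * N)))) by lia.
    rewrite (tech5 h (S (S (2*N)))), (tech5 h (S (2*N))), IH.
    replace (S (S (S (2 * N)))) with (S (2 * S N)) by lia.
    replace (S (S (2 * N))) with (2 * S N)%nat by lia.
    rewrite H0, H1, !tech5. lra.
Qed.

Lemma outer_le_union (A B : RSet) (r s : R) :
  outer_le A r -> outer_le B s -> outer_le (fun x => A x \/ B x) (r + s).
Proof.
  rewrite !outer_leE. intros HA HB eps He.
  destruct (HA (eps / 2)) as (a & b & Hab & Hc & Hs); [lra|].
  destruct (HB (eps / 2)) as (a' & b' & Hab' & Hc' & Hs'); [lra|].
  (* Even indices list the cover of [A], odd ones the cover of [B], each within [eps / 2]. *)
  exists (fun n => if Nat.even n then a (Nat.div2 n) else a' (Nat.div2 n)),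
         (fun n => if Nat.even n then b (Nat.div2 n) else b' (Nat.div2 n)).
  split; [intro n; destruct (Nat.even n); auto|split].
  - intros x [Hx|Hx].
    + destruct (Hc x Hx) as [n Hn]. exists (2 * n)%nat.
      rewrite Nat.even_mul, Nat.div2_double. exact Hn.
    + destruct (Hc' x Hx) as [n Hn]. exists (S (2 * n)).
      rewrite Nat.even_succ, Nat.odd_mul, Nat.div2_succ_double. exact Hn.
  - intro N.
    apply Rle_trans with (sum_f_R0 (fun n => if Nat.even n then (b (Nat.div2 n) - a (Nat.div2 n))
       else (b' (Nat.div2 n) - a' (Nat.div2 n))) (S (2 * N))).
    + set (h := fun n => if Nat.even n then _ - _ else _).
      rewrite (sum_eq _ h).
      2:{ intros i _. unfold h. destruct (Nat.even i); reflexivity. }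
      assert (Hh : forall n, 0 <= h n).
      { intro n. unfold h. destruct (Nat.even n);
          [specialize (Hab (Nat.div2 n))|specialize (Hab' (Nat.div2 n))]; lra. }
      assert (forall d, sum_f_R0 h N <= sum_f_R0 h (N + d)).
      { induction d as [|d IHd]; [rewrite Nat.add_0_r; lra|].
        rewrite Nat.add_succ_r, tech5. specialize (Hh (S (N + d))). lra. }
      specialize (H (S N)). replace (N + S N)%nat with (S (2 * N)) in H by lia. exact H.
    + rewrite (sum_interleave (fun n => b n - a n) (fun n => b' n - a' n)).
      specialize (Hs N). specialize (Hs' N). lra.
Qed.

Definition fin (A : RSet) : Prop := exists r, outer_le A r.

Lemma outer_eq_exists (A : RSet) : fin A -> exists r, outer_eq A r.
Proof.
  intros [r0 H0].
  (* The infimum of the admissible bounds is minus the supremum of their negatives. *)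
  destruct (completeness (fun t => outer_le A (- t))) as [t [Hub Hlub]].
  - exists 0. intros t Ht. apply outer_le_ge0 in Ht. lra.
  - exists (- r0). rewrite Ropp_involutive. exact H0.
  - exists (- t). split.
    + apply outer_leE. intros eps He.
      assert (Hex : exists u, outer_le A (- u) /\ t - eps / 2 < u).
      { apply NNPP. intro Hn. assert (t <= t - eps / 2); [|lra].
        apply Hlub. intros u Hu. destruct (Rle_or_lt u (t - eps / 2)) as [H|H]; [exact H|].
        exfalso. apply Hn. exists u. split; assumption. }
      destruct Hex as (u & Hu & Htu).
      destruct (proj1 (outer_leE _ _) Hu (eps / 2)) as (a & b & Hab & Hc & Hs); [lra|].
      exists a, b. split; [exact Hab|split; [exact Hc|]].
      intro N. specialize (Hs N). lra.
    + intros r' Hr'. assert (- r' <= t); [|lra].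
      apply Hub. rewrite Ropp_involutive. exact Hr'.
Qed.

(** Outer measure as a total function. Its value on sets of infinite outer measure is unspecified,
    hence the [fin] premises that follow. *)
Definition mu (A : RSet) : R := epsilon (inhabits 0) (outer_eq A).

Lemma mu_spec (A : RSet) : fin A -> outer_eq A (mu A).
Proof. intro H. apply (epsilon_spec (inhabits 0) (outer_eq A)), outer_eq_exists, H. Qed.

Lemma outer_eq_mu (A : RSet) (r : R) : outer_eq A r -> mu A = r.
Proof.
  intros [H1 H2]. destruct (mu_spec A) as [H3 H4]; [exists r; exact H1|].
  apply Rle_antisym; auto.
Qed.

Lemma mu_le (A : RSet) (r : R) : outer_le A r -> mu A <= r.
Proof. intro H. apply (mu_spec A); [exists r|]; exact H. Qed.

Lemma fin_sub (A B : RSet) : (forall x, A x -> B x) -> fin B -> fin A.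
Proof. intros H [r Hr]. exists r. apply outer_le_sub with B r; auto; lra. Qed.

Lemma mu_sub (A B : RSet) : (forall x, A x -> B x) -> fin B -> mu A <= mu B.
Proof.
  intros H HB. apply mu_le. apply outer_le_sub with B (mu B); [exact H|lra|].
  apply mu_spec, HB.
Qed.

Lemma mu_ext (A B : RSet) : (forall x, A x <-> B x) -> mu A = mu B.
Proof.
  intro H. destruct (excluded_middle_informative (fin B)) as [HB|HB].
  - apply Rle_antisym; apply mu_sub; try (intros x; apply H); auto.
    apply fin_sub with B; [apply H|exact HB].
  (* Here [mu B] is unspecified, so the two predicates themselves are identified. *)
  - assert (E : A = B); [|rewrite E; reflexivity].
    apply functional_extensionality. intro x.
    apply propositional_extensionality, H.
Qed.

Lemma mu_ge0 (A : RSet) : fin A -> 0 <= mu A.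
Proof. intro H. apply outer_le_ge0 with A, mu_spec, H. Qed.

Lemma fin_union (A B : RSet) : fin A -> fin B -> fin (fun x => A x \/ B x).
Proof. intros [r Hr] [s Hs]. exists (r + s). apply outer_le_union; assumption. Qed.

Lemma mu_union_le (A B : RSet) : fin A -> fin B -> mu (fun x => A x \/ B x) <= mu A + mu B.
Proof. intros HA HB. apply mu_le, outer_le_union; apply mu_spec; assumption. Qed.

Notation meas := lebesgue_measurable.

Lemma measE (A : RSet) :
  meas A <-> forall E, fin E -> mu (fun x => E x /\ A x) + mu (fun x => E x /\ ~ A x) <= mu E.
Proof.
  split.
  - intros HA E HE. destruct (HA E (mu E)) as (r1 & r2 & H1 & H2 & H); [apply mu_spec, HE|].
    apply mu_le in H1, H2. lra.
  - intros HA E r Hr. assert (HE : fin E) by (exists r; exact Hr).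
    exists (mu (fun x => E x /\ A x)), (mu (fun x => E x /\ ~ A x)).
    split; [|split].
    + apply mu_spec. apply fin_sub with E; [tauto|exact HE].
    + apply mu_spec. apply fin_sub with E; [tauto|exact HE].
    + specialize (HA E HE). apply mu_le in Hr. lra.
Qed.

Lemma mu_split (A E : RSet) : meas A -> fin E ->
  mu E = mu (fun x => E x /\ A x) + mu (fun x => E x /\ ~ A x).
Proof.
  intros HA HE. apply Rle_antisym; [|apply measE; assumption].
  apply Rle_trans with (mu (fun x => (E x /\ A x) \/ (E x /\ ~ A x))).
  - apply mu_sub; [intros x Hx; destruct (classic (A x)); tauto|].
    apply fin_sub with E; [tauto|exact HE].
  - apply mu_union_le; apply fin_sub with E; tauto.
Qed.

Lemma mu_empty (A : RSet) : (forall x, ~ A x) -> mu A = 0.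
Proof.
  intro H. assert (HA : outer_le A 0).
  { apply outer_leE. intros eps He. exists (fun _ => 0), (fun _ => 0).
    split; [intro; lra|split; [intros x Hx; elim (H x Hx)|]].
    intro N. replace (sum_f_R0 _ N) with 0; [lra|].
    induction N as [|N IH]; simpl; lra. }
  apply Rle_antisym; [apply mu_le, HA|apply mu_ge0; exists 0; exact HA].
Qed.

Lemma meas_ext (A B : RSet) : (forall x, A x <-> B x) -> meas A -> meas B.
Proof.
  intros H HA. apply measE. intros E HE.
  rewrite (mu_split A E HA HE). right. f_equal; apply mu_ext; intro x; specialize (H x); tauto.
Qed.

Lemma meas_not (A : RSet) : meas A -> meas (fun x => ~ A x).
Proof.
  intro HA. apply measE. intros E HE.
  rewrite (mu_split A E HA HE). right. rewrite Rplus_comm. f_equal.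
  apply mu_ext. intro x. destruct (classic (A x)); tauto.
Qed.

Lemma meas_and (A B : RSet) : meas A -> meas B -> meas (fun x => A x /\ B x).
Proof.
  intros HA HB. apply measE. intros E HE.
  assert (HEA : fin (fun x => E x /\ A x)) by (apply fin_sub with E; tauto).
  rewrite (mu_split A E HA HE), (mu_split B _ HB HEA).
  rewrite (mu_ext (fun x => E x /\ A x /\ B x) (fun x => (E x /\ A x) /\ B x)) by (intro; tauto).
  rewrite Rplus_assoc. apply Rplus_le_compat_l.
  apply Rle_trans with (mu (fun x => ((E x /\ A x) /\ ~ B x) \/ (E x /\ ~ A x))).
  - apply mu_sub; [intros x Hx; destruct (classic (A x)); tauto|].
    apply fin_sub with E; tauto.
  - apply mu_union_le; apply fin_sub with E; tauto.
Qed.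

Lemma meas_or (A B : RSet) : meas A -> meas B -> meas (fun x => A x \/ B x).
Proof.
  intros HA HB. apply meas_ext with (fun x => ~ (~ A x /\ ~ B x)).
  - intro x. destruct (classic (A x)), (classic (B x)); tauto.
  - apply meas_not, meas_and; apply meas_not; assumption.
Qed.

Lemma meas_diff (A B : RSet) : meas A -> meas B -> meas (fun x => A x /\ ~ B x).
Proof. intros HA HB. apply (meas_and A (fun x => ~ B x)); [|apply meas_not]; assumption. Qed.

Lemma meas_empty : meas (fun _ => False).
Proof.
  apply measE. intros E HE. rewrite (mu_empty (fun x => E x /\ False)) by tauto.
  rewrite Rplus_0_l. apply mu_sub; [tauto|exact HE].
Qed.

Lemma meas_full : meas (fun _ => True).
Proof. apply meas_ext with (fun _ => ~ False); [tauto|apply meas_not, meas_empty]. Qed.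

Lemma mu_union (A B : RSet) : meas A -> fin A -> fin B -> (forall x, ~ (A x /\ B x)) ->
  mu (fun x => A x \/ B x) = mu A + mu B.
Proof.
  intros HA FA FB Hd. rewrite (mu_split A _ HA (fin_union A B FA FB)).
  f_equal; apply mu_ext; intro x; specialize (Hd x); tauto.
Qed.

Lemma outer_le_ico (a b : R) : a <= b -> outer_le (fun x => a <= x < b) (b - a).
Proof.
  intro Hab. apply outer_leE. intros eps He.
  exists (fun n => match n with O => a - eps | _ => 0 end),
         (fun n => match n with O => b | _ => 0 end).
  split; [intros [|n]; lra|split; [intros x Hx; exists O; lra|]].
  intro N. induction N as [|N IH]; simpl in *; lra.
Qed.

(** Each interval of a nearly optimal cover of [E] is cut at [c]. The lengths of its two parts add
    up to its own, so covering both halves of [E] costs no more than covering [E]. *)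
Lemma meas_lt (c : R) : meas (fun x => x < c).
Proof.
  apply measE. intros E HE.
  apply Rnot_lt_le. intro Hlt.
  set (r := mu E) in *.
  set (r1 := mu (fun x => E x /\ x < c)) in *.
  set (r2 := mu (fun x => E x /\ ~ x < c)) in *.
  destruct (proj1 (mu_spec E HE) ((r1 + r2 - r) / 2)) as (a & b & Hab & Hc & s & Hs & Hle);
    [lra|]. fold r in Hle.
  set (f1 := fun n => Rmin (b n) c - Rmin (a n) c).
  set (f2 := fun n => Rmax (b n) c - Rmax (a n) c).
  assert (Hf1 : forall n, 0 <= f1 n).
  { intro n. specialize (Hab n). unfold f1, Rmin.
    destruct (Rle_dec (b n) c), (Rle_dec (a n) c); lra. }
  assert (Hf2 : forall n, 0 <= f2 n).
  { intro n. specialize (Hab n). unfold f2, Rmax.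
    destruct (Rle_dec (b n) c), (Rle_dec (a n) c); lra. }
  assert (Hf : forall n, f1 n + f2 n = b n - a n).
  { intro n. specialize (Hab n). unfold f1, f2, Rmax, Rmin.
    destruct (Rle_dec (b n) c), (Rle_dec (a n) c); lra. }
  assert (HN : forall N, sum_f_R0 f1 N + sum_f_R0 f2 N <= s).
  { intro N. rewrite <- sum_plus, (sum_eq _ _ N (fun i _ => Hf i)).
    apply sum_incr; [exact Hs|]. intro n. specialize (Hab n). lra. }
  assert (Hmono : forall f N M, (forall n, 0 <= f n) -> (N <= M)%nat -> sum_f_R0 f N <= sum_f_R0 f M).
  { intros f N M Hp HNM. induction HNM as [|M _ IH]; [lra|].
    rewrite tech5. specialize (Hp (S M)). lra. }
  destruct (series_below f1 s Hf1) as (s1 & Hs1 & _).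
  { intro N. specialize (HN N). assert (0 <= sum_f_R0 f2 N) by (apply cond_pos_sum, Hf2). lra. }
  (* The right parts are bounded by what the limit [s1] of the left parts leaves: otherwise some
     joint partial sum would exceed [s]. *)
  assert (Hlim : forall N, sum_f_R0 f2 N <= s - s1).
  { intro N. apply Rnot_lt_le. intro Hn.
    destruct (Hs1 (sum_f_R0 f2 N - (s - s1))) as [N1 HN1]; [lra|].
    specialize (HN1 (Nat.max N N1) (Nat.le_max_r _ _)). unfold Rdist in HN1.
    specialize (HN (Nat.max N N1)).
    assert (Hm := Hmono f2 N (Nat.max N N1) Hf2 (Nat.le_max_l _ _)).
    apply Rabs_def2 in HN1. lra. }
  assert (H1 : r1 <= s1).
  { apply mu_le, outer_leE. intros eps He.
    exists (fun n => Rmin (a n) c), (fun n => Rmin (b n) c).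
    split; [intro n; specialize (Hf1 n); unfold f1 in Hf1; lra|split].
    - intros x [Hx Hxc]. destruct (Hc x Hx) as [n Hn]. exists n.
      unfold Rmin. destruct (Rle_dec (b n) c), (Rle_dec (a n) c); lra.
    - intro N. apply Rle_trans with s1; [|lra]. apply (sum_incr f1); assumption. }
  (* The right parts are open at [c] and may miss that point, which is covered separately at cost
     zero, written [c - c]. *)
  assert (H2 : r2 <= (s - s1) + (c - c)).
  { apply mu_le. apply outer_le_sub with
      (fun x => (E x /\ c < x) \/ (x = c)) ((s - s1) + (c - c)); [|lra|].
    - intros x [Hx Hxc]. destruct (Req_dec x c); [right; assumption|left; split; [exact Hx|lra]].
    - apply outer_le_union.
      + apply outer_leE. intros eps He.
        exists (fun n => Rmax (a n) c), (fun n => Rmax (b n) c).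
        split; [intro n; specialize (Hf2 n); unfold f2 in Hf2; lra|split].
        * intros x [Hx Hxc]. destruct (Hc x Hx) as [n Hn]. exists n.
          unfold Rmax. destruct (Rle_dec (b n) c), (Rle_dec (a n) c); lra.
        * intro N. apply Rle_trans with (s - s1); [apply Hlim|lra].
      + apply outer_leE. intros eps He.
        exists (fun n => match n with O => c - eps/2 | _ => 0 end),
               (fun n => match n with O => c + eps/2| _ => 0 end).
        split; [intros [|n]; lra|split; [intros x Hx; exists O; lra|]].
        intro N. induction N as [|N IH]; simpl in *; lra. }
  lra.
Qed.

Lemma meas_ico (a b : R) : meas (fun x => a <= x < b).
Proof.
  apply meas_ext with (fun x => ~ x < a /\ x < b); [intro x; lra|].
  apply meas_and; [apply meas_not|]; apply meas_lt.
Qed.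

(* The supremum of the [x] for which finitely many of the intervals already
   account for the length of [[c, x]] lies in some interval of the cover. *)
Lemma cover_length (c d : R) (a b : nat -> R) :
  c <= d -> (forall n, a n <= b n) -> (forall x, c <= x <= d -> exists n, a n < x < b n) ->
  exists N, d - c <= sum_f_R0 (fun n => b n - a n) N.
Proof.
  intros Hcd Hab Hc.
  (* The length of the part of the interval of index [n] inside [[c, x]]. *)
  set (len := fun x n => Rmax 0 (Rmin (b n) x - Rmax (a n) c)).
  set (P := fun x => c <= x <= d /\ exists N, x - c <= sum_f_R0 (len x) N).
  assert (Hpos : forall x n, 0 <= len x n) by (intros; apply Rmax_l).
  assert (Hmono : forall x N M, (N <= M)%nat -> sum_f_R0 (len x) N <= sum_f_R0 (len x) M).
  { intros x N M HNM. induction HNM as [|M _ IH]; [lra|].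
    rewrite tech5. specialize (Hpos x (S M)). lra. }
  assert (Hlen : forall x y n, x <= y -> len x n <= len y n).
  { intros x y n Hxy. unfold len, Rmax, Rmin.
    repeat destruct (Rle_dec _ _); lra. }
  assert (Pc : P c).
  { split; [lra|]. exists O. simpl. specialize (Hpos c O). lra. }
  destruct (completeness P) as [z [Hub Hlub]].
  { exists d. intros x [Hx _]. lra. }
  { exists c. exact Pc. }
  assert (Hcz : c <= z) by (apply Hub, Pc).
  assert (Hzd : z <= d) by (apply Hlub; intros x [Hx _]; lra).
  destruct (Hc z) as [j Hj]; [lra|].
  assert (Hex : exists x, P x /\ a j < x <= z).
  { apply NNPP. intro Hn. assert (z <= Rmax c (a j)).
    { apply Hlub. intros x Px. destruct (Rle_or_lt x (a j)) as [H|H].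
      - apply Rle_trans with (a j); [exact H|apply Rmax_r].
      - exfalso. apply Hn. exists x. split; [exact Px|]. split; [exact H|apply Hub, Px]. }
    unfold Rmax in H. destruct (Rle_dec c (a j)); [lra|].
    apply Hn. exists c. split; [exact Pc|lra]. }
  destruct Hex as (x & (Hx & N & HN) & Hxz).
  assert (Hstep : forall y, x <= y -> y <= b j ->
            y - x + sum_f_R0 (len x) (Nat.max N j) <= sum_f_R0 (len y) (Nat.max N j)).
  { intros y Hxy Hyb. generalize (Nat.le_max_r N j). generalize (Nat.max N j).
    assert (Hd : forall f g M, (forall n, f n <= g n) -> sum_f_R0 f M <= sum_f_R0 g M).
    { intros f g M Hfg. apply sum_growing. exact Hfg. }
    assert (Hjj : y - x + len x j <= len y j).
    { unfold len, Rmax, Rmin. repeat destruct (Rle_dec _ _); lra. }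
    intros M HM. induction M as [|M IH].
    - assert (j = 0)%nat by lia. subst j. simpl. exact Hjj.
    - rewrite !tech5. destruct (Nat.eq_dec j (S M)) as [Ej|Ej].
      + rewrite <- Ej. specialize (Hd (len x) (len y) M (fun n => Hlen x y n Hxy)). lra.
      + specialize (IH ltac:(lia)). specialize (Hlen x y (S M) Hxy). lra. }
  assert (Hreach : forall y, x <= y -> y <= b j -> y <= d -> P y).
  { intros y H1 H2 H3. split; [lra|]. exists (Nat.max N j).
    specialize (Hstep y H1 H2). specialize (Hmono x N _ (Nat.le_max_l N j)). lra. }
  assert (Pd : P d).
  { destruct (Rle_or_lt d (b j)) as [H|H]; [apply Hreach; lra|].
    assert (b j <= z); [|lra]. apply Hub, Hreach; lra. }
  destruct Pd as [_ [M HM]]. exists M.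
  apply Rle_trans with (1 := HM). apply sum_growing. intro n.
  specialize (Hab n). unfold len, Rmax, Rmin. repeat destruct (Rle_dec _ _); lra.
Qed.

Lemma fin_ico (a b : R) : fin (fun x => a <= x < b).
Proof.
  destruct (Rle_or_lt a b) as [H|H]; [exists (b - a); apply outer_le_ico, H|].
  apply fin_sub with (fun x => b <= x < a); [intros; lra|].
  exists (a - b). apply outer_le_ico. lra.
Qed.

Lemma mu_ico (a b : R) : a <= b -> mu (fun x => a <= x < b) = b - a.
Proof.
  intro Hab. apply outer_eq_mu. split; [apply outer_le_ico, Hab|].
  intros r Hr. apply Rnot_lt_le. intro Hlt.
  (* With a third of the supposed gap, the cover costs at most [r + h], while the compact interval
     [[a, b - h]] has length [r + 2 * h]. *)
  set (h := (b - a - r) / 3).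
  destruct (proj1 (outer_leE _ _) Hr h) as (u & v & Huv & Hc & Hs); [unfold h; lra|].
  apply outer_le_ge0 in Hr.
  destruct (cover_length a (b - h) u v) as [N HN]; auto; [unfold h; lra| |].
  - intros x Hx. apply Hc. unfold h in Hx. lra.
  - specialize (Hs N). unfold h in *. lra.
Qed.

(** * Independent subsets and copies of colorings *)

Definition inside (B : R) (A : RSet) : Prop := forall x, A x -> 0 <= x < B.

Lemma inside_fin (B : R) (A : RSet) : inside B A -> fin A.
Proof. intro H. apply fin_sub with (fun x => 0 <= x < B); [exact H|apply fin_ico]. Qed.

Lemma unit_color_setE (m : R) (A : RSet) :
  unit_color_set m A <-> inside m A /\ meas A /\ mu A = 1.
Proof.
  split; intros (H1 & H2 & H3); (split; [exact H1|split; [exact H2|]]).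
  - apply outer_eq_mu, H3.
  - rewrite <- H3. apply mu_spec, inside_fin with m, H1.
Qed.

(** The measure of the part of [E] below [x] is 1-Lipschitz in [x] and rises from 0 to [mu E], so
    the intermediate value theorem gives a cut point for every fraction. *)
Lemma meas_fraction (E : RSet) (B f : R) : meas E -> inside B E -> 0 <= f <= 1 ->
  exists D, meas D /\ (forall x, D x -> E x) /\ mu D = f * mu E.
Proof.
  intros HE HB Hf.
  assert (FE : fin E) by (apply inside_fin with B, HB).
  set (F := fun x => mu (fun y => E y /\ y < x)).
  assert (FF : forall x, fin (fun y => E y /\ y < x)) by (intro x; apply fin_sub with E; tauto).
  assert (Hlip : forall x y, x <= y -> F x <= F y <= F x + (y - x)).
  { intros x y Hxy. split.
    - apply mu_sub; [|apply FF]. intros t [Ht Htx]. split; [exact Ht|lra].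
    - unfold F. rewrite <- (mu_ico x y Hxy).
      apply Rle_trans with (mu (fun t => (E t /\ t < x) \/ (x <= t < y))).
      + apply mu_sub; [intros t [Ht Hty]; destruct (Rlt_dec t x); [left; tauto|right; lra]|].
        apply fin_union; [apply FF|apply fin_ico].
      + apply mu_union_le; [apply FF|apply fin_ico]. }
  assert (Hcont : continuity (fun x => F x - f * mu E)).
  { intros x eps He. exists eps. split; [exact He|]. intros y [_ Hy].
    simpl in *. unfold Rdist in *. apply Rabs_def2 in Hy. apply Rabs_def1;
    destruct (Rle_or_lt x y) as [H|H];
      [specialize (Hlip x y H)|specialize (Hlip y x (Rlt_le _ _ H))|
       specialize (Hlip x y H)|specialize (Hlip y x (Rlt_le _ _ H))]; lra. }
  assert (H0 : F 0 = 0).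
  { apply mu_empty. intros x [Hx Hx0]. specialize (HB x Hx). lra. }
  assert (H1 : F (Rmax 0 B) = mu E).
  { apply mu_ext. intro x. split; [tauto|]. intro Hx. split; [exact Hx|].
    specialize (HB x Hx). apply Rlt_le_trans with B; [lra|apply Rmax_r]. }
  assert (Hmu := mu_ge0 E FE).
  destruct (IVT_cor _ 0 (Rmax 0 B) Hcont) as [z [Hz Hz0]].
  - apply Rmax_l.
  - rewrite H0, H1. assert (0 <= f * mu E) by (apply Rmult_le_pos; lra).
    assert (0 <= (1 - f) * mu E) by (apply Rmult_le_pos; lra). nra.
  - exists (fun x => E x /\ x < z). split; [|split].
    + apply meas_and; [exact HE|apply meas_lt].
    + tauto.
    + unfold F in Hz0. lra.
Qed.

(** Induction on the list: the head splits [E], and the fraction [f] is taken in both parts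
    independently of the tail, which is why [E] is quantified after the list. For [f = 0] the result
    is empty and not merely null, because colorings must be disjoint at every point. *)
Lemma independent_part (As : list RSet) (f B : R) : 0 <= f <= 1 -> Forall meas As ->
  forall E, meas E -> inside B E -> exists D, meas D /\ (forall x, D x -> E x) /\
    mu D = f * mu E /\ (f = 0 -> forall x, ~ D x) /\
    forall A, In A As -> mu (fun x => D x /\ A x) = f * mu (fun x => E x /\ A x).
Proof.
  intros Hf HAs. induction HAs as [|A As HA HAs IH]; intros E HE HB.
  - destruct (Req_dec f 0) as [Ef|Ef].
    + exists (fun _ => False). split; [apply meas_empty|].
      rewrite (mu_empty (fun _ => False)), Ef by tauto.
      split; [tauto|]. split; [lra|]. split; [tauto|]. intros A [].
    + destruct (meas_fraction E B f HE HB Hf) as (D & H1 & H2 & H3).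
      exists D. repeat (split; [assumption|]). split; [tauto|]. intros A [].
  - assert (FE : fin E) by (apply inside_fin with B, HB).
    destruct (IH (fun x => E x /\ A x)) as (D1 & M1 & S1 & E1 & Z1 & I1).
    { apply meas_and; assumption. }
    { intros x [Hx _]. auto. }
    destruct (IH (fun x => E x /\ ~ A x)) as (D2 & M2 & S2 & E2 & Z2 & I2).
    { apply meas_diff; assumption. }
    { intros x [Hx _]. auto. }
    assert (F1 : fin D1) by (apply fin_sub with E; firstorder).
    assert (F2 : fin D2) by (apply fin_sub with E; firstorder).
    exists (fun x => D1 x \/ D2 x). split; [apply meas_or; assumption|].
    split; [firstorder|]. split.
    { rewrite mu_union; [|assumption..|intros x [H1 H2]; apply S1 in H1; apply S2 in H2; tauto].
      rewrite E1, E2, (mu_split A E HA FE). lra. }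
    split; [firstorder|]. intros C [<-|HC].
    + rewrite (mu_ext _ D1); [exact E1|].
      intro x. specialize (S1 x). specialize (S2 x). tauto.
    + specialize (I1 C HC). specialize (I2 C HC).
      assert (MC : meas C) by (rewrite Forall_forall in HAs; auto).
      rewrite (mu_ext _ (fun x => (D1 x /\ C x) \/ (D2 x /\ C x))) by (intro; tauto).
      rewrite mu_union.
      * rewrite I1, I2, (mu_split A (fun x => E x /\ C x) HA) by (apply fin_sub with E; tauto).
        rewrite (mu_ext (fun x => (E x /\ A x) /\ C x) (fun x => (E x /\ C x) /\ A x)) by (intro; tauto).
        rewrite (mu_ext (fun x => (E x /\ ~ A x) /\ C x) (fun x => (E x /\ C x) /\ ~ A x)) by (intro; tauto).
        lra.
      * apply meas_and; assumption.
      * apply fin_sub with D1; tauto.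
      * apply fin_sub with D2; tauto.
      * intros x [[H1 _] [H2 _]]. apply S1 in H1. apply S2 in H2. tauto.
Qed.

(** This copies the set system [phi] from [E] into [E'], scaling all pairwise overlaps by [kappa],
    also within each set of [As]. Induction on [n]: [phi n] cuts [E] in two, [E'] is cut in the same
    proportion independently of [As], and the earlier sets are copied into both parts. *)
Lemma transfer (phi : nat -> RSet) (As : list RSet) (kappa : RSet -> R) (B : R) :
  Forall meas As -> forall n, (forall v, (v < n)%nat -> meas (phi v)) ->
  forall E E', meas E -> fin E -> meas E' -> inside B E' -> mu E' = kappa (fun _ => True) * mu E ->
  (forall A, In A As -> mu (fun x => E' x /\ A x) = kappa A * mu E) ->
  exists c : nat -> RSet,
    (forall v, (v < n)%nat -> meas (c v)) /\
    (forall v x, (v < n)%nat -> c v x -> E' x) /\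
    (forall u v, (u < n)%nat -> (v < n)%nat ->
       (forall x, ~ (phi u x /\ phi v x /\ E x)) -> forall x, ~ (c u x /\ c v x)) /\
    (forall u v, (u < n)%nat -> (v < n)%nat ->
       forall A, In A ((fun _ => True) :: As) ->
       mu (fun x => c u x /\ c v x /\ A x) = kappa A * mu (fun x => phi u x /\ phi v x /\ E x)).
Proof.
  intros HAs n. induction n as [|n IH]; intros Hphi E E' HE FE HE' HB Hfull Hk.
  { exists (fun _ _ => False). repeat split; intros; lia. }
  assert (Hp : meas (phi n)) by (apply Hphi; lia).
  assert (FE' : fin E') by (apply inside_fin with B, HB).
  set (E1 := fun x => E x /\ phi n x). set (E2 := fun x => E x /\ ~ phi n x).
  assert (FE1 : fin E1) by (apply fin_sub with E; firstorder).
  assert (FE2 : fin E2) by (apply fin_sub with E; firstorder).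
  assert (ME1 : meas E1) by (apply meas_and; assumption).
  assert (ME2 : meas E2) by (apply meas_diff; assumption).
  assert (Hsum := mu_split (phi n) E Hp FE). fold E1 E2 in Hsum.
  assert (P1 := mu_ge0 E1 FE1). assert (P2 := mu_ge0 E2 FE2).
  (* [f] is the relative measure of [phi n] in [E]. It must be 0 whenever [mu E1 = 0], also if
     [mu E = 0], so that an empty overlap has an empty copy. *)
  assert (Hfex : exists f, 0 <= f <= 1 /\ mu E1 = f * mu E /\ (mu E1 = 0 -> f = 0)).
  { destruct (Req_dec (mu E) 0) as [Z|Z].
    - exists 0. lra.
    - exists (mu E1 / mu E). split; [split|split].
      + apply Rle_mult_inv_pos; lra.
      + apply Rmult_le_reg_r with (mu E); [lra|]. unfold Rdiv. rewrite Rmult_assoc, Rinv_l; lra.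
      + field. exact Z.
      + intros ->. field. exact Z. }
  destruct Hfex as (f & Hf & Hf1 & Hf0).
  destruct (independent_part As f B Hf HAs E' HE' HB) as (E1' & M1 & S1 & T1 & Z1 & I1).
  set (E2' := fun x => E' x /\ ~ E1' x).
  assert (M2 : meas E2') by (apply meas_diff; assumption).
  assert (HA2 : forall A, meas A ->
     mu (fun x => E' x /\ A x) = mu (fun x => E1' x /\ A x) + mu (fun x => E2' x /\ A x)).
  { intros A MA. rewrite (mu_split E1' (fun x => E' x /\ A x) M1) by (apply fin_sub with E'; tauto).
    f_equal; apply mu_ext; intro x; specialize (S1 x); unfold E2'; tauto. }
  destruct (IH ltac:(intros; apply Hphi; lia) E1 E1' ME1 FE1 M1)
    as (c1 & C1m & C1s & C1d & C1k).
  { intros x Hx. auto. }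
  { rewrite T1, Hfull, Hf1. ring. }
  { intros A HA. rewrite I1, Hk, Hf1 by exact HA. ring. }
  destruct (IH ltac:(intros; apply Hphi; lia) E2 E2' ME2 FE2 M2)
    as (c2 & C2m & C2s & C2d & C2k).
  { intros x [Hx _]. auto. }
  { assert (H := mu_split E1' E' M1 FE'). fold E2' in H.
    rewrite (mu_ext (fun x => E' x /\ E1' x) E1') in H by (intro x; specialize (S1 x); tauto).
    rewrite T1, Hfull in H. rewrite Hf1 in Hsum. replace (mu E2) with (mu E - f * mu E) by lra. lra. }
  { intros A HA. rewrite Forall_forall in HAs. assert (H := HA2 A (HAs A HA)).
    rewrite I1, Hk in H by exact HA. replace (mu E2) with (mu E - f * mu E) by lra. lra. }
  set (c := fun v x => if Nat.eq_dec v n then E1' x else c1 v x \/ c2 v x).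
  assert (Hcn : forall x, c n x <-> E1' x).
  { intro x. unfold c. destruct (Nat.eq_dec n n); tauto. }
  assert (Hcv : forall v x, (v < n)%nat -> (c v x <-> c1 v x \/ c2 v x)).
  { intros v x Hv. unfold c. destruct (Nat.eq_dec v n); [lia|tauto]. }
  assert (HE1full : mu E1' = kappa (fun _ => True) * mu E1).
  { rewrite T1, Hfull, Hf1. ring. }
  assert (Hsplit : forall u v A, (u < n)%nat -> (v < n)%nat -> meas A ->
     mu (fun x => c u x /\ c v x /\ A x)
     = mu (fun x => c1 u x /\ c1 v x /\ A x) + mu (fun x => c2 u x /\ c2 v x /\ A x)).
  { intros u v A Hu Hv MA. rewrite <- mu_union.
    - apply mu_ext. intro x. rewrite !Hcv by assumption.
      assert (K1 := C1s u x Hu). assert (K2 := C1s v x Hv).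
      assert (K3 := C2s u x Hu). assert (K4 := C2s v x Hv). unfold E2' in *. tauto.
    - apply meas_and; [auto|apply meas_and; auto].
    - apply fin_sub with E'; [|exact FE']. intros x [Hx _]. apply S1. eauto.
    - apply fin_sub with E'; [|exact FE']. intros x [Hx _]. apply C2s in Hx; [|exact Hu]. apply Hx.
    - intros x [[H1 _] [H2 _]]. apply C1s in H1; [|exact Hu]. apply C2s in H2; [|exact Hu].
      destruct H2; tauto. }
  assert (Hpn : forall v, (v < n)%nat -> forall A, In A ((fun _ => True) :: As) ->
     mu (fun x => c n x /\ c v x /\ A x) = kappa A * mu (fun x => phi n x /\ phi v x /\ E x)).
  { intros v Hv A HA. specialize (C1k v v Hv Hv A HA).
    rewrite (mu_ext _ (fun x => c1 v x /\ c1 v x /\ A x)).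
    - rewrite C1k. f_equal. apply mu_ext. intro x. unfold E1. tauto.
    - intro x. rewrite Hcn, Hcv by exact Hv. assert (K1 := C1s v x Hv). assert (K2 := C2s v x Hv).
      unfold E2' in K2. tauto. }
  assert (Hdn : forall v, (v < n)%nat -> (forall x, ~ (phi n x /\ phi v x /\ E x)) ->
      forall x, ~ (c n x /\ c v x)).
  { intros v Hv H x. rewrite Hcn, Hcv by exact Hv. intros [H1 H2].
    assert (K2 := C2s v x Hv). unfold E2' in K2.
    apply (C1d v v Hv Hv) with x; [|tauto].
    intros y (Hy & _ & Hy'). apply (H y). unfold E1 in Hy'. tauto. }
  exists c. split; [|split; [|split]].
  - intros v Hv. destruct (Nat.eq_dec v n) as [->|Hn].
    + apply meas_ext with E1'; [intro x; symmetry; apply Hcn|exact M1].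
    + apply meas_ext with (fun x => c1 v x \/ c2 v x); [intro x; symmetry; apply Hcv; lia|].
      apply meas_or; [apply C1m|apply C2m]; lia.
  - intros v x Hv. destruct (Nat.eq_dec v n) as [->|Hn].
    + rewrite Hcn. apply S1.
    + rewrite Hcv by lia. intros [H|H]; [apply S1, (C1s v); [lia|exact H]|].
      apply C2s in H; [|lia]. apply H.
  - intros u v Hu Hv H x.
    destruct (Nat.eq_dec u n) as [->|Hun], (Nat.eq_dec v n) as [->|Hvn].
    + rewrite Hcn. intros [Hx _].
      apply (Z1 (Hf0 (mu_empty E1 ltac:(intros y Hy; apply (H y); unfold E1 in Hy; tauto))) x Hx).
    + apply Hdn; [lia|exact H].
    + intros [H1 H2]. apply (Hdn u) with x; [lia| |tauto]. intros y Hy. apply (H y). tauto.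
    + rewrite !Hcv by lia. intros [H1 H2].
      assert (K1 := C1s u x ltac:(lia)). assert (K2 := C2s u x ltac:(lia)).
      assert (K3 := C1s v x ltac:(lia)). assert (K4 := C2s v x ltac:(lia)).
      assert (L1 := C1d u v ltac:(lia) ltac:(lia)). assert (L2 := C2d u v ltac:(lia) ltac:(lia)).
      specialize (L1 ltac:(intros y Hy; apply (H y); unfold E1 in Hy; tauto) x).
      specialize (L2 ltac:(intros y Hy; apply (H y); unfold E2 in Hy; tauto) x).
      unfold E2' in *. tauto.
  - intros u v Hu Hv A HA.
    destruct (Nat.eq_dec u n) as [->|Hun], (Nat.eq_dec v n) as [->|Hvn].
    + rewrite (mu_ext (fun x => phi n x /\ phi n x /\ E x) E1) by (intro; unfold E1; tauto).
      destruct HA as [<-|HA].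
      * rewrite (mu_ext _ E1'); [exact HE1full|]. intro x. rewrite Hcn. tauto.
      * rewrite (mu_ext _ (fun x => E1' x /\ A x)) by (intro x; rewrite Hcn; tauto).
        rewrite I1, Hk, Hf1 by exact HA. ring.
    + apply Hpn; [lia|exact HA].
    + rewrite (mu_ext _ (fun x => c n x /\ c u x /\ A x)) by (intro; tauto).
      rewrite (mu_ext (fun x => phi u x /\ phi n x /\ E x) (fun x => phi n x /\ phi u x /\ E x))
        by (intro; tauto).
      apply Hpn; [lia|exact HA].
    + assert (MA : meas A).
      { destruct HA as [<-|HA]; [apply meas_full|]. rewrite Forall_forall in HAs. auto. }
      rewrite Hsplit, C1k, C2k by (lia || assumption).
      rewrite (mu_split (phi n) (fun x => phi u x /\ phi v x /\ E x) Hp)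
        by (apply fin_sub with E; tauto).
      rewrite <- Rmult_plus_distr_l. f_equal. f_equal; apply mu_ext; intro x; unfold E1, E2; tauto.
Qed.

(** * Upper bound *)

Lemma choose_family {A B : Type} (P : A -> B -> Prop) :
  (forall a, exists b, P a b) -> exists f, forall a, P a (f a).
Proof.
  intro H. exists (fun a => proj1_sig (constructive_indefinite_description _ (H a))).
  intro a. apply proj2_sig.
Qed.

Lemma walk1 adj u v : adj u v -> walk adj u v 1.
Proof. intro H. apply walkS with v; [exact H|apply walk0]. Qed.

Section Extension.

Variables (k eps : R) (n : nat) (adj : nat -> nat -> Prop).
Hypothesis k_range : 2 <= k < 3.
Hypothesis eps_gt0 : 0 < eps.
Hypothesis eps_large : 1 <= eps * (k + eps).
Hypothesis graph_adj : simple_graph n adj.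
Variable phi : nat -> RSet.
Hypothesis phi_col : frac_coloring n adj k phi.
Variable W : nat -> Prop.
Hypothesis W_lt : forall w, W w -> (w < n)%nat.
Hypothesis W_far : far_apart adj W 6.
Variable p : nat -> RSet.
Hypothesis p_col : precoloring (k + eps) W p.

Let m := k + eps.
Let al := / m.

Lemma m_gt2 : 2 < m. Proof. unfold m. lra. Qed.
Lemma al_m : al * m = 1. Proof. unfold al. apply Rinv_l. assert (H := m_gt2). lra. Qed.
Lemma al_range : 0 < al < 1 / 2.
Proof. assert (H := m_gt2). assert (H' := al_m). split; nra. Qed.
(** The threshold enters here: [Star], of measure [al], has to fit into the measure [eps] that
    [Base] leaves free. *)
Lemma al_eps : al <= eps.
Proof. assert (H := al_m). assert (H' := al_range). unfold m in *. nra. Qed.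

Lemma phi_in v : (v < n)%nat -> inside k (phi v).
Proof. intro Hv. apply (proj1 (unit_color_setE _ _) (proj1 phi_col v Hv)). Qed.
Lemma phi_meas v : (v < n)%nat -> meas (phi v).
Proof. intro Hv. apply (proj1 (unit_color_setE _ _) (proj1 phi_col v Hv)). Qed.
Lemma phi_mu v : (v < n)%nat -> mu (phi v) = 1.
Proof. intro Hv. apply (proj1 (unit_color_setE _ _) (proj1 phi_col v Hv)). Qed.
Lemma adj_lt u v : adj u v -> (u < n)%nat /\ (v < n)%nat.
Proof. apply graph_adj. Qed.
Lemma adj_sym u v : adj u v -> adj v u.
Proof. apply graph_adj. Qed.
Lemma p_in w : W w -> inside m (p w).
Proof. intro Hw. apply (proj1 (unit_color_setE _ _) (p_col w Hw)). Qed.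
Lemma p_meas w : W w -> meas (p w).
Proof. intro Hw. apply (proj1 (unit_color_setE _ _) (p_col w Hw)). Qed.
Lemma p_mu w : W w -> mu (p w) = 1.
Proof. intro Hw. apply (proj1 (unit_color_setE _ _) (p_col w Hw)). Qed.

(** The guard makes every entry of [As] measurable although the list runs over all vertices: [p] is
    arbitrary outside [W]. *)
Let pW v : RSet := fun x => W v /\ p v x.
Let As := map pW (seq 0 n).

Lemma meas_As : Forall meas As.
Proof.
  apply Forall_forall. intros A HA. apply in_map_iff in HA. destruct HA as (v & <- & _).
  destruct (classic (W v)) as [Hv|Hv].
  - apply meas_ext with (p v); [intro; unfold pW; tauto|apply p_meas, Hv].
  - apply meas_ext with (fun _ => False); [intro; unfold pW; tauto|apply meas_empty].
Qed.

Lemma pW_in w : W w -> In (pW w) As.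
Proof. intro Hw. apply in_map, in_seq. specialize (W_lt w Hw). lia. Qed.

Lemma pWE w : W w -> forall x, pW w x <-> p w x.
Proof. unfold pW. tauto. Qed.

Lemma palette_split : exists Base Star : RSet,
  meas Base /\ meas Star /\ inside m Base /\ inside m Star /\ (forall x, ~ (Base x /\ Star x)) /\
  mu Base = k /\ mu Star = al /\
  (forall w, W w -> mu (fun x => Base x /\ p w x) = k * al) /\
  (forall w, W w -> mu (fun x => Star x /\ p w x) = al * al).
Proof.
  assert (Hm := m_gt2). assert (Ha := al_m). assert (Hr := al_range). assert (He := al_eps).
  set (I := fun x => 0 <= x < m).
  assert (MI : mu I = m) by (unfold I; rewrite mu_ico; lra).
  (* The fraction [k * al] of [[0, m)] has measure [k]; the fraction [al / eps] of the remaining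
     measure [eps] is [al]. *)
  destruct (independent_part As (k * al) m) with (E := I) as (Base & MB & SB & TB & _ & IB).
  { unfold m in *. nra. }
  { apply meas_As. }
  { apply meas_ico. }
  { intros x Hx. exact Hx. }
  destruct (independent_part As (al / eps) m) with (E := fun x => I x /\ ~ Base x)
    as (Star & MS & SS & TS & _ & IS).
  { split; [apply Rle_mult_inv_pos; lra|]. apply Rmult_le_reg_r with eps; [lra|].
    unfold Rdiv. rewrite Rmult_assoc, Rinv_l; lra. }
  { apply meas_As. }
  { apply meas_diff; [apply meas_ico|exact MB]. }
  { intros x [Hx _]. exact Hx. }
  assert (FI : fin I) by apply fin_ico.
  rewrite MI in TB.
  assert (EB : mu Base = k) by (rewrite TB; replace (k * al * m) with (k * (al * m)) by ring; rewrite Ha; ring).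
  assert (EN : mu (fun x => I x /\ ~ Base x) = eps).
  { assert (H := mu_split Base I MB FI). rewrite MI in H.
    rewrite (mu_ext (fun x => I x /\ Base x) Base), EB in H by (intro x; specialize (SB x); tauto).
    unfold m in H. lra. }
  assert (PB : forall w, W w -> mu (fun x => Base x /\ p w x) = k * al).
  { intros w Hw. specialize (IB (pW w) (pW_in w Hw)).
    rewrite (mu_ext (fun x => Base x /\ p w x) (fun x => Base x /\ pW w x))
      by (intro x; rewrite (pWE w Hw); tauto).
    rewrite IB, (mu_ext _ (p w)), (p_mu w Hw); [ring|].
    intro x. rewrite (pWE w Hw). assert (H := p_in w Hw x). unfold I. tauto. }
  exists Base, Star. split; [exact MB|]. split; [exact MS|].
  split; [intros x Hx; apply SB, Hx|]. split; [intros x Hx; apply SS, Hx|].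
  split; [intros x [H1 H2]; apply SS in H2; tauto|]. split; [exact EB|].
  split; [rewrite TS, EN; field; lra|]. split; [exact PB|].
  intros w Hw. specialize (IS (pW w) (pW_in w Hw)).
  rewrite (mu_ext (fun x => Star x /\ p w x) (fun x => Star x /\ pW w x))
      by (intro x; rewrite (pWE w Hw); tauto).
  rewrite IS.
  assert (H := mu_split Base (p w) MB ltac:(apply inside_fin with m, p_in, Hw)).
  rewrite (p_mu w Hw), (mu_ext (fun x => p w x /\ Base x) (fun x => Base x /\ p w x)),
    (PB w Hw) in H by (intro; tauto).
  rewrite (mu_ext _ (fun x => p w x /\ ~ Base x)).
  (* From [al * m = 1] one gets [1 - k * al = eps * al]. *)
  - replace (mu (fun x => p w x /\ ~ Base x)) with (eps * al).
    + field. lra.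
    + unfold m in Ha. lra.
  - intro x. rewrite (pWE w Hw). assert (K := p_in w Hw x). unfold I. tauto.
Qed.

Lemma far_unique w w' l : W w -> W w' -> (l < 6)%nat -> walk adj w w' l -> w = w'.
Proof.
  intros Hw Hw' Hl Hwalk. destruct (Nat.eq_dec w w') as [E|E]; [exact E|].
  elim (W_far w w' Hw Hw' E l Hl Hwalk).
Qed.

(** Three disjoint sets of measure one do not fit into [[0, k)] when [k < 3]. *)
Lemma no_triangle u v w : adj u v -> adj v w -> adj u w -> False.
Proof.
  intros H1 H2 H3. destruct (adj_lt _ _ H1) as [Lu Lv]. destruct (adj_lt _ _ H2) as [_ Lw].
  assert (D1 := proj2 phi_col _ _ H1). assert (D2 := proj2 phi_col _ _ H2).
  assert (D3 := proj2 phi_col _ _ H3).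
  assert (Iu := phi_in u Lu). assert (Iv := phi_in v Lv). assert (Iw := phi_in w Lw).
  assert (Fu := inside_fin _ _ Iu). assert (Fv := inside_fin _ _ Iv). assert (Fw := inside_fin _ _ Iw).
  assert (E : mu (fun x => phi u x \/ (phi v x \/ phi w x)) = 3).
  { rewrite mu_union, mu_union, !phi_mu; auto using phi_meas, fin_union; try lra.
    intros x [K1 [K2|K2]]; [apply (D1 x)|apply (D3 x)]; tauto. }
  assert (L : mu (fun x => phi u x \/ (phi v x \/ phi w x)) <= mu (fun x => 0 <= x < k)).
  { apply mu_sub; [|apply fin_ico]. intros x [K|[K|K]]; auto. }
  rewrite mu_ico in L; lra.
Qed.

Let level1 w v := W w /\ adj w v.
Let level2 w v := ~ W v /\ (forall w', ~ level1 w' v) /\ exists u, level1 w u /\ adj u v.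

Lemma precoloring_extends : extends n adj m W p.
Proof.
  assert (Hm := m_gt2). assert (Ha := al_m). assert (Hr := al_range).
  destruct palette_split as (Base & Star & MB & MS & InB & InS & BS & EB & ES & PB & PS).
  assert (FB := inside_fin _ _ InB). assert (FS := inside_fin _ _ InS).
  assert (PhiM : forall v, (v < n)%nat -> meas (phi v)) by exact phi_meas.
  (* With this factor the overlaps of the sets [C] equal those of [phi], and a fraction [al] of each
     overlap lies in [p w]. *)
  destruct (transfer phi As (fun A => mu (fun x => Base x /\ A x) / k) m meas_As n PhiM
    (fun x => 0 <= x < k) Base) as (C & MC & SC & DC & KC).
  { apply meas_ico. } { apply fin_ico. } { exact MB. } { exact InB. }
  { rewrite mu_ico, (mu_ext (fun x => Base x /\ True) Base) by (tauto || lra). field. lra. }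
  { intros A _. rewrite mu_ico by lra. field. lra. }
  (* These overlaps determine how much a vertex at distance 2 loses to [D w] and must regain inside
     [Star]. *)
  set (gam := fun u v => mu (fun x => phi u x /\ phi v x)).
  assert (GE : forall u v, (u < n)%nat ->
     mu (fun x => phi u x /\ phi v x /\ 0 <= x < k) = gam u v).
  { intros u v Hu. apply mu_ext. intro x. assert (H := phi_in u Hu x). tauto. }
  assert (GS : forall v, (v < n)%nat -> gam v v = 1).
  { intros v Hv. unfold gam. rewrite <- (phi_mu v Hv). apply mu_ext. tauto. }
  assert (FC : forall v, (v < n)%nat -> fin (C v)).
  { intros v Hv. apply fin_sub with Base; [intro x; apply SC, Hv|exact FB]. }
  assert (CC : forall u v, (u < n)%nat -> (v < n)%nat ->
     mu (fun x => C u x /\ C v x) = gam u v).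
  { intros u v Hu Hv. specialize (KC u v Hu Hv (fun _ => True) (or_introl eq_refl)).
    rewrite (GE u v Hu), (mu_ext (fun x => Base x /\ True) Base), EB in KC by tauto.
    rewrite (mu_ext _ (fun x => C u x /\ C v x /\ True)) by tauto. rewrite KC. field. lra. }
  assert (CP : forall u v w, (u < n)%nat -> (v < n)%nat -> W w ->
     mu (fun x => C u x /\ C v x /\ p w x) = al * gam u v).
  { intros u v w Hu Hv Hw. specialize (KC u v Hu Hv (pW w) (or_intror (pW_in w Hw))).
    rewrite (GE u v Hu), (mu_ext (fun x => Base x /\ pW w x) (fun x => Base x /\ p w x)),
      (PB w Hw) in KC by (intro x; rewrite (pWE w Hw); tauto).
    rewrite (mu_ext _ (fun x => C u x /\ C v x /\ pW w x))
      by (intro x; rewrite (pWE w Hw); tauto). rewrite KC. field. lra. }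
  assert (C1 : forall v, (v < n)%nat -> mu (C v) = 1).
  { intros v Hv. rewrite <- (GS v Hv), <- (CC v v Hv Hv). apply mu_ext. tauto. }
  assert (CN : forall u v w, (u < n)%nat -> (v < n)%nat -> W w ->
     mu (fun x => (C u x /\ C v x) /\ ~ p w x) = (1 - al) * gam u v).
  { intros u v w Hu Hv Hw.
    assert (H := mu_split (p w) (fun x => C u x /\ C v x) (p_meas w Hw)
      ltac:(apply fin_sub with (C u); [tauto|auto])).
    rewrite (CC u v Hu Hv), (mu_ext _ (fun x => C u x /\ C v x /\ p w x)), (CP u v w Hu Hv Hw) in H
      by tauto. lra. }
  assert (HD : forall w, exists D : RSet, W w -> meas D /\ (forall x, D x -> C w x /\ ~ p w x) /\
     mu D = al * al /\
     forall u, (u < n)%nat -> mu (fun x => C u x /\ D x) = al * al * gam u w).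
  { intro w. destruct (classic (W w)) as [Hw|Hw]; [|exists (fun _ => True); tauto].
    assert (Lw := W_lt w Hw).
    (* [C w] outside [p w] has measure [1 - al], so this fraction of it has measure [al * al]; it is
       at most 1 because [al < 1 / 2]. *)
    set (f := al * al / (1 - al)).
    assert (Ef : f * (1 - al) = al * al) by (unfold f; field; lra).
    destruct (independent_part (map C (seq 0 n)) f m) with (E := fun x => C w x /\ ~ p w x)
      as (D & MD & SD & ED & _ & ID).
    - split; [apply Rle_mult_inv_pos; [apply Rmult_le_pos|]; lra|].
      apply Rmult_le_reg_r with (1 - al); [lra|]. rewrite Ef. nra.
    - apply Forall_forall. intros A HA. apply in_map_iff in HA.
      destruct HA as (v & <- & Hv). apply in_seq in Hv. apply MC. lia.
    - apply meas_diff; auto using p_meas.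
    - intros x [Hx _]. apply InB, (SC w x Lw Hx).
    - exists D. intros _. split; [exact MD|]. split; [exact SD|]. split.
      + rewrite ED, (mu_ext _ (fun x => (C w x /\ C w x) /\ ~ p w x)), CN, GS by (tauto || assumption). lra.
      + intros u Hu. rewrite (mu_ext _ (fun x => D x /\ C u x)) by tauto.
        rewrite (ID (C u)) by (apply in_map, in_seq; lia).
        rewrite (mu_ext _ (fun x => (C u x /\ C w x) /\ ~ p w x)), CN by (tauto || assumption).
        rewrite <- Ef. ring. }
  destruct (choose_family _ HD) as [D HD']. clear HD.
  assert (HG : forall w, exists G : nat -> RSet, W w ->
     (forall u, (u < n)%nat -> meas (G u) /\ (forall x, G u x -> Star x /\ p w x) /\
        mu (G u) = al * al * gam u w) /\
     forall u v, adj u v -> forall x, ~ (G u x /\ G v x)).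
  { intro w. destruct (classic (W w)) as [Hw|Hw]; [|exists (fun _ _ => True); tauto].
    assert (Lw := W_lt w Hw).
    (* Copying [phi w], of measure one, into a set of measure [al * al] scales each overlap with
       [phi w] by [al * al], which is exactly the loss to [D w]. *)
    destruct (transfer phi nil (fun _ => al * al) m (Forall_nil _) n PhiM
      (phi w) (fun x => Star x /\ p w x)) as (G & MG & SG & DG & KG).
    - auto.
    - apply inside_fin with k, phi_in, Lw.
    - apply meas_and; auto using p_meas.
    - intros x [Hx _]. auto.
    - rewrite (PS w Hw), (phi_mu w Lw). ring.
    - intros A [].
    - exists G. intros _. split.
      + intros u Hu. split; [auto|]. split; [intros x Hx; apply (SG u x Hu Hx)|].
        specialize (KG u u Hu Hu (fun _ => True) (or_introl eq_refl)).
        rewrite (mu_ext _ (fun x => G u x /\ G u x /\ True)) by tauto. rewrite KG.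
        f_equal. apply mu_ext. tauto.
      + intros u v Huv. destruct (adj_lt u v Huv) as [Hu Hv]. apply DG; [assumption..|].
        intros x Hx. apply (proj2 phi_col u v Huv x). tauto. }
  destruct (choose_family _ HG) as [G HG']. clear HG.
  set (c := fun v x =>
    (W v /\ p v x) \/
    (~ W v /\ exists w, level1 w v /\ ((C v x /\ ~ p w x) \/ (Star x /\ ~ p w x) \/ D w x)) \/
    (exists w, level2 w v /\ ((C v x /\ ~ D w x) \/ G w v x)) \/
    (~ W v /\ (forall w, ~ level1 w v) /\ (forall w, ~ level2 w v) /\ C v x)).
  (* Two roots serving the same vertex would be joined by a walk of length 2 here, and of length 4
     in [U2]. *)
  assert (U1 : forall v w w', level1 w v -> level1 w' v -> w = w').
  { intros v w w' [Hw H] [Hw' H']. apply (far_unique w w' 2); auto.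
    apply walkS with v; [exact H|]. apply walk1, adj_sym, H'. }
  assert (U2 : forall v w w', level2 w v -> level2 w' v -> w = w').
  { intros v w w' (_ & _ & u & [Hw H] & Hu) (_ & _ & u' & [Hw' H'] & Hu').
    apply (far_unique w w' 4); auto.
    apply walkS with u; [exact H|]. apply walkS with v; [exact Hu|].
    apply walkS with u'; [apply adj_sym, Hu'|]. apply walk1, adj_sym, H'. }
  assert (L1W : forall w v, level1 w v -> ~ W v).
  { intros w v [Hw H] Hv. assert (E : w = v) by (apply (far_unique w v 1); [exact Hw|exact Hv|lia|apply walk1, H]).
    subst v. apply (proj2 (proj2 graph_adj) w H). }
  assert (cW : forall v, W v -> forall x, c v x <-> p v x).
  { intros v Hv x. unfold c. split; [|tauto].
    intros [[_ H]|[[H _]|[(w & (H & _) & _)|[H _]]]]; tauto. }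
  assert (c1 : forall w v, level1 w v -> forall x, c v x <->
     (C v x /\ ~ p w x) \/ (Star x /\ ~ p w x) \/ D w x).
  { intros w v Hl x. assert (Hv := L1W w v Hl). unfold c. split.
    - intros [H|[(_ & w' & Hl' & H)|[(w' & (_ & H & _) & _)|(_ & H & _)]]].
      + tauto.
      + rewrite (U1 v w w' Hl Hl'). exact H.
      + elim (H w Hl).
      + elim (H w Hl).
    - intro H. right. left. split; [exact Hv|]. exists w. tauto. }
  assert (c2 : forall w v, level2 w v -> forall x, c v x <-> (C v x /\ ~ D w x) \/ G w v x).
  { intros w v Hl x. unfold c. split.
    - intros [[H _]|[(_ & w' & Hl' & _)|[(w' & Hl' & H)|(_ & _ & H & _)]]].
      + elim (proj1 Hl H).
      + elim (proj1 (proj2 Hl) w' Hl').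
      + rewrite (U2 v w w' Hl Hl'). exact H.
      + elim (H w Hl).
    - intro H. right. right. left. exists w. tauto. }
  assert (c3 : forall v, ~ W v -> (forall w, ~ level1 w v) -> (forall w, ~ level2 w v) ->
     forall x, c v x <-> C v x).
  { intros v H0 H1 H2 x. unfold c. split; [|tauto].
    intros [[H _]|[(_ & w' & H & _)|[(w' & H & _)|H]]]; [tauto|elim (H1 w' H)|elim (H2 w' H)|tauto]. }
  assert (Lev : forall v, W v \/ (exists w, level1 w v) \/ (exists w, level2 w v) \/
     (~ W v /\ (forall w, ~ level1 w v) /\ (forall w, ~ level2 w v))).
  { intro v. destruct (classic (W v)); [tauto|]. right.
    destruct (classic (exists w, level1 w v)) as [H1|H1]; [tauto|]. right.
    destruct (classic (exists w, level2 w v)) as [H2|H2]; [tauto|]. right.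
    firstorder. }
  assert (CD : forall u v, adj u v -> forall x, ~ (C u x /\ C v x)).
  { intros u v Huv. destruct (adj_lt u v Huv) as [Hu Hv]. apply DC; [assumption..|].
    intros x Hx. apply (proj2 phi_col u v Huv x). tauto. }
  exists c. split; [split|exact cW].
  - intros v Hv. apply unit_color_setE.
    destruct (Lev v) as [Hl|[[w Hl]|[[w Hl]|(H0 & H1 & H2)]]].
    + assert (E := cW v Hl). split; [intros x Hx; apply (p_in v Hl), E, Hx|].
      split; [apply meas_ext with (p v); [intro; symmetry; apply E|apply p_meas, Hl]|].
      rewrite (mu_ext _ _ E). apply p_mu, Hl.
    + assert (E := c1 w v Hl). assert (Hw := proj1 Hl). assert (Lw := W_lt w Hw).
      destruct (HD' w Hw) as (MD & SD & ED & _). assert (MP := p_meas w Hw).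
      assert (Hvw : forall x, ~ (C w x /\ C v x)) by (apply CD, Hl).
      assert (FD : fin (D w)) by (apply fin_sub with (C w); [apply SD|auto]).
      split; [|split].
      * intros x Hx. apply E in Hx. destruct Hx as [[Hx _]|[[Hx _]|Hx]].
        -- apply InB, (SC v x Hv Hx).
        -- auto.
        -- apply SD in Hx. apply InB, (SC w x Lw). tauto.
      * apply meas_ext with (fun x => (C v x /\ ~ p w x) \/ (Star x /\ ~ p w x) \/ D w x);
          [intro; symmetry; apply E|].
        repeat apply meas_or; try exact MD; apply meas_diff; auto.
      (* The three parts have measures [1 - al], [al - al * al] and [al * al]. *)
      * rewrite (mu_ext _ _ E), mu_union, mu_union.
        -- rewrite ED, (mu_ext _ (fun x => (C v x /\ C v x) /\ ~ p w x)), CN, GS by (tauto || assumption).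
           assert (H := mu_split (p w) Star MP FS). rewrite (PS w Hw), ES in H. lra.
        -- apply meas_diff; auto.
        -- apply fin_sub with Star; tauto.
        -- exact FD.
        -- intros x [H1 H2]. apply SD in H2. apply (BS x). split; [|tauto]. apply (SC w x Lw). tauto.
        -- apply meas_diff; auto.
        -- apply fin_sub with (C v); auto; tauto.
        -- apply fin_union; [apply fin_sub with Star; tauto|exact FD].
        -- intros x [H1 [H2|H2]].
           ++ apply (BS x). split; [apply (SC v x Hv)|]; tauto.
           ++ apply SD in H2. apply (Hvw x). tauto.
    + assert (E := c2 w v Hl). assert (Hw : W w) by (destruct Hl as (_ & _ & u & [Hw _] & _); exact Hw).
      assert (Lw := W_lt w Hw).
      destruct (HD' w Hw) as (MD & SD & ED & KD).
      destruct (HG' w Hw) as (HGu & _). destruct (HGu v Hv) as (MG & SG & EG).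
      assert (FG : fin (G w v)) by (apply fin_sub with Star; [apply SG|exact FS]).
      split; [|split].
      * intros x Hx. apply E in Hx. destruct Hx as [[Hx _]|Hx].
        -- apply InB, (SC v x Hv Hx).
        -- apply InS, SG, Hx.
      * apply meas_ext with (fun x => (C v x /\ ~ D w x) \/ G w v x); [intro; symmetry; apply E|].
        apply meas_or; [apply meas_diff; auto|exact MG].
      (* The loss to [D w] and the gain from [G w v] are both [al * al * gam v w]. *)
      * rewrite (mu_ext _ _ E), mu_union.
        -- rewrite EG. assert (H := mu_split (D w) (C v) MD (FC v Hv)).
           rewrite (C1 v Hv), (KD v Hv) in H. lra.
        -- apply meas_diff; auto.
        -- apply fin_sub with (C v); auto; tauto.
        -- exact FG.
        -- intros x [H1 H2]. apply SG in H2. apply (BS x). split; [apply (SC v x Hv)|]; tauto.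
    + assert (E := c3 v H0 H1 H2). split; [intros x Hx; apply E in Hx; apply InB, (SC v x Hv Hx)|].
      split; [apply meas_ext with (C v); [intro; symmetry; apply E|auto]|].
      rewrite (mu_ext _ _ E). auto.
  - assert (HC : forall w v, level2 w v -> W w).
    { intros w v (_ & _ & u & [Hw _] & _). exact Hw. }
    assert (Hn : forall w v u, level1 w u -> adj u v -> ~ W v -> (forall w', ~ level1 w' v) ->
      level2 w v).
    { intros w v u Hl Huv H0 H1. split; [exact H0|]. split; [exact H1|]. exists u. tauto. }
    assert (P0 : forall u v, adj u v -> W u -> forall x, ~ (c u x /\ c v x)).
    { intros u v Huv Hu x. destruct (HD' u Hu) as (_ & SD & _).
      rewrite (cW u Hu), (c1 u v (conj Hu Huv)). specialize (SD x). tauto. }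
    assert (P1 : forall u v w, adj u v -> level1 w u -> forall x, ~ (c u x /\ c v x)).
    { intros u v w Huv Hl x. assert (Hw := proj1 Hl). assert (Lw := W_lt w Hw).
      destruct (adj_lt u v Huv) as [Hu Hv].
      destruct (classic (W v)) as [H0|H0].
      { intro H. apply (P0 v u (adj_sym _ _ Huv) H0 x). tauto. }
      destruct (classic (exists w', level1 w' v)) as [[w' H1]|H1].
      (* If both ends are neighbours of roots, the walk of length 3 forces a common root, which then
         closes a triangle. *)
      { assert (w = w').
        { apply (far_unique w w' 3); [exact Hw|apply H1|lia|].
          apply walkS with u; [apply Hl|]. apply walkS with v; [exact Huv|].
          apply walk1, adj_sym, H1. }
        subst w'. elim (no_triangle u v w Huv); apply adj_sym; [apply H1|apply Hl]. }
      assert (H2 : level2 w v) by (apply Hn with u; firstorder).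
      (* [Star] outside [p w] avoids [G w v], which lies inside [p w]; [D w] is removed from [C v]
         and, lying in [Base], avoids [G w v]. *)
      rewrite (c1 w u Hl), (c2 w v H2).
      destruct (HD' w Hw) as (_ & SD & _). destruct (HG' w Hw) as (HGu & _).
      destruct (HGu v Hv) as (_ & SG & _).
      specialize (SD x). specialize (SG x). assert (K1 := SC u x Hu). assert (K2 := SC v x Hv).
      assert (K3 := SC w x Lw). assert (K4 := CD u v Huv x). specialize (BS x). tauto. }
    assert (P2 : forall u v w, adj u v -> level2 w u -> forall x, ~ (c u x /\ c v x)).
    { intros u v w Huv Hl x. assert (Hw := HC w u Hl).
      destruct (adj_lt u v Huv) as [Hu Hv].
      destruct (HG' w Hw) as (HGu & GD).
      destruct (HGu u Hu) as (_ & SGu & _). destruct (HGu v Hv) as (_ & SGv & _).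
      specialize (SGu x). specialize (SGv x).
      assert (K1 := SC u x Hu). assert (K2 := SC v x Hv). assert (K4 := CD u v Huv x).
      specialize (BS x). specialize (GD u v Huv x).
      destruct (Lev v) as [H0|[[w' H1]|[[w' H2]|(H0 & H1 & H2)]]].
      - intro H. apply (P0 v u (adj_sym _ _ Huv) H0 x). tauto.
      - intro H. apply (P1 v u w' (adj_sym _ _ Huv) H1 x). tauto.
      (* Distance 6 is used in full here, against a walk of length 5: the two compensating sets are
         disjoint because they belong to the same root. *)
      - assert (w = w').
        { destruct Hl as (_ & _ & a & [_ Hwa] & Hau). assert (Hw' := HC w' v H2).
          destruct H2 as (_ & _ & b & [_ Hb] & Hb').
          apply (far_unique w w' 5); auto.
          apply walkS with a; [exact Hwa|]. apply walkS with u; [exact Hau|].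
          apply walkS with v; [exact Huv|]. apply walkS with b; [apply adj_sym, Hb'|].
          apply walk1, adj_sym, Hb. }
        subst w'. rewrite (c2 w u Hl), (c2 w v H2). tauto.
      - rewrite (c2 w u Hl), (c3 v H0 H1 H2). tauto. }
    intros u v Huv x.
    destruct (Lev u) as [H0|[[w H1]|[[w H2]|(H0 & H1 & H2)]]]; [eauto..|].
    destruct (Lev v) as [H0'|[[w' H1']|[[w' H2']|(H0' & H1' & H2')]]].
    + intro H. apply (P0 v u (adj_sym _ _ Huv) H0' x). tauto.
    + intro H. apply (P1 v u w' (adj_sym _ _ Huv) H1' x). tauto.
    + intro H. apply (P2 v u w' (adj_sym _ _ Huv) H2' x). tauto.
    + rewrite (c3 u H0 H1 H2), (c3 v H0' H1' H2'). apply CD, Huv.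
Qed.

End Extension.

Lemma ext_property_large (k eps : R) : 2 <= k < 3 -> 0 < eps -> 1 <= eps * (k + eps) ->
  ext_property k 6 eps.
Proof.
  intros Hk He Hl n adj Hg [phi Hphi] W HW Hfar p Hp.
  apply (precoloring_extends k eps n adj Hk He Hl Hg phi Hphi W HW Hfar p Hp).
Qed.

(** * The weighted graph for [k] in [[5/2, 3)] *)

From HB Require Import structures.
From mathcomp Require Import all_boot zify.
Set Implicit Arguments.
Unset Strict Implicit.
Unset Printing Implicit Defensive.
Open Scope R_scope.

(** For indices below [n], the residue of [i - t]: the number of steps forward from [t] to [i] on
    the cycle. *)
Definition cdiff (n i t : nat) : nat := ((i + (n - t)) %% n)%N.

Section CyclicArcs.
Local Open Scope nat_scope.
Variable n : nat.
Implicit Types i j t : 'I_n.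

Lemma cdiff_lt i (t : nat) : cdiff n i t < n.
Proof. by rewrite ltn_mod (leq_ltn_trans _ (ltn_ord i)). Qed.

Lemma cdiffE i t : cdiff n i t = if t <= i then i - t else i + n - t.
Proof.
rewrite /cdiff; have := ltn_ord i; have := ltn_ord t => ht hi.
case: leqP => h.
  rewrite addnBA 1?ltnW // -addnBAC // modnDr modn_small //; lia.
rewrite modn_small; lia.
Qed.

Lemma cdiff_add i j t : cdiff n i t = (cdiff n i j + cdiff n j t) %% n.
Proof.
rewrite /cdiff modnDml modnDmr.
have -> : i + (n - j) + (j + (n - t)) = i + (n - t) + n.
  by have := ltn_ord j; lia.
by rewrite modnDr.
Qed.

Lemma cdiff_injl t : injective (fun i => Ordinal (cdiff_lt i t)).
Proof.
move=> i i' /(congr1 val) /= /eqP; rewrite /cdiff eqn_modDr !modn_small // => /eqP.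
exact: val_inj.
Qed.

Lemma cdiff_injr i : injective (fun t => Ordinal (cdiff_lt i t)).
Proof.
move=> t t' /(congr1 val) /=; rewrite !cdiffE => h; apply: val_inj => /=; move: h.
have := ltn_ord t; have := ltn_ord t'; have := ltn_ord i.
by case: (leqP t i); case: (leqP t' i) => *; lia.
Qed.

Lemma card_ord_lt r : r <= n -> #|[set d : 'I_n | d < r]| = r.
Proof.
move=> hr; rewrite cardsE -sum1_card -(big_ord_widen _ (fun=> 1)) //.
by rewrite sum1_card card_ord.
Qed.

Lemma card_arcl r t : r <= n -> #|[set i : 'I_n | cdiff n i t < r]| = r.
Proof.
move=> hr; rewrite -[RHS](card_ord_lt hr) -(card_preimset [set d : 'I_n | d < r] (@cdiff_injl t)).
by apply: eq_card => i; rewrite !inE.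
Qed.

Lemma card_arcr r i : r <= n -> #|[set t : 'I_n | cdiff n i t < r]| = r.
Proof.
move=> hr; rewrite -[RHS](card_ord_lt hr) -(card_preimset [set d : 'I_n | d < r] (@cdiff_injr i)).
by apply: eq_card => t; rewrite !inE.
Qed.

Definition below s (L : {set 'I_n}) := [set t : 'I_n | [exists j in L, cdiff n j t <= s]].

(** A Cauchy-Davenport bound for adding an interval: until the cycle is full, each further step
    backwards gains a new point. *)
Lemma card_below (L : {set 'I_n}) s : L != set0 -> minn n (#|L| + s) <= #|below s L|.
Proof.
case/set0Pn=> j0 j0L; elim: s => [|s IHs].
  rewrite addn0 geq_min; apply/orP; right; apply/subset_leq_card/subsetP => t tL.
  rewrite inE; apply/existsP; exists t; rewrite tL cdiffE leqnn subnn //.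
have sub : below s L \subset below s.+1 L.
  apply/subsetP => t; rewrite !inE => /existsP[j /andP[jL h]].
  by apply/existsP; exists j; rewrite jL (leq_trans h).
have [full|/subsetPn[t0 _ ht0]] := boolP ([set: 'I_n] \subset below s L).
  by have := subset_leq_card (subset_trans full sub); rewrite cardsT card_ord geq_min => ->.
(* Take the first missing point met when going backwards from [j0]. Its successor is not missing, so
   one more step catches it. *)
case: (arg_minnP (P := fun t => t \notin below s L) (cdiff n j0) ht0) => t ht tmin.
have tpos : 0 < cdiff n j0 t.
  rewrite lt0n; apply: contra ht => /eqP h.
  by rewrite inE; apply/existsP; exists j0; rewrite j0L h.
have stepE (j : 'I_n) : cdiff n j t <= (cdiff n j (ordS t)).+1.
  rewrite !cdiffE /=; have := ltn_ord t; have := ltn_ord j => jn.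
  rewrite leq_eqVlt => /orP[/eqP tn|tn].
    rewrite tn modnn leq0n; case: (leqP t j); lia.
  by rewrite modn_small //; case: (leqP t j); case: (leqP t.+1 j); lia.
have lt_step : cdiff n j0 (ordS t) < cdiff n j0 t.
  move: tpos; rewrite !cdiffE /=; have := ltn_ord t; have := ltn_ord j0 => jn.
  rewrite leq_eqVlt => /orP[/eqP tn|tn].
    rewrite tn modnn leq0n; case: (leqP t j0); lia.
  by rewrite modn_small //; case: (leqP t j0); case: (leqP t.+1 j0); lia.
have tS : t \in below s.+1 L.
  have : ordS t \in below s L.
    by apply: contraLR lt_step => /tmin; rewrite -leqNgt.
  rewrite !inE => /existsP[j /andP[jL h]]; apply/existsP; exists j.
  by rewrite jL (leq_trans (stepE j)).
have : #|t |: below s L| <= #|below s.+1 L|.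
  by apply/subset_leq_card; rewrite subUset sub1set tS.
rewrite cardsU1 ht /= => h; apply: leq_trans h; apply: leq_trans (leq_add (leqnn 1) IHs).
by rewrite addnS; move: (_ + s) => a; lia.
Qed.

End CyclicArcs.

(** * The weighted graph, its coloring and its independent sets *)

Section OddGadget.
Local Open Scope nat_scope.
Variables q r : nat.
Hypotheses (qr : q <= 2 * r) (rq : r < q).
Let n := q + r.

(** Moving [L] back by [r] turns the window from [r] to [2 * r] into one from 0 to [r], to which
    [card_below] applies; nothing wraps around since [2 * r < n]. *)
Lemma card_between (L : {set 'I_n}) : L != set0 ->
  minn n (#|L| + r) <= #|[set t : 'I_n | [exists j in L, r <= cdiff n j t <= 2 * r]]|.
Proof.
have rn : r < n by rewrite /n; lia.
pose sh (j : 'I_n) : 'I_n := Ordinal (cdiff_lt j r).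
have sh_inj : injective sh.
  move=> j j' /(congr1 val) /= h; apply: (@cdiff_injl n (Ordinal rn)).
  exact: val_inj.
have shE (j : 'I_n) : cdiff n j (sh j) = r.
  rewrite cdiffE /= (cdiffE j (Ordinal rn)) /=; have := ltn_ord j => jn.
  by case: (leqP r j) => h1; case: leqP; lia.
move=> L0; have L'0 : sh @: L != set0.
  by case/set0Pn: L0 => j jL; apply/set0Pn; exists (sh j); apply: imset_f.
have := card_below r L'0; rewrite card_imset // => /leq_trans; apply.
apply/subset_leq_card/subsetP => t; rewrite !inE => /existsP[_ /andP[/imsetP[j jL ->]] h].
apply/existsP; exists j; rewrite jL (cdiff_add _ (sh j)) shE modn_small ?leq_addr //=.
  by move: h => /=; lia.
by have nE : n = q + r := erefl; move: h => /=; lia.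
Qed.

(* The [2 q + r] colors are the cyclic group of order [n] and a set of [q] further
   colors, all of them used by the root.  [inl (inl t)], [inl (inr t)],
   [inr (inl t)] are the vertices of types [v], [s], [l]; adjacency is just what
   [odd_stable] needs, and is compatible with [odd_color]. *)
Definition odd_vertex := ('I_n + 'I_n + ('I_n + unit))%type.

Definition odd_arc (a b : odd_vertex) : bool :=
  match a, b with
  | inl (inl _), inr (inr _) => true
  | inl (inl t), inl (inr t') => t == t'
  | inl (inl t), inr (inl j) => cdiff n j t <= 2 * r - q
  | inl (inr t), inr (inl j) => r <= cdiff n j t <= 2 * r
  | _, _ => false
  end.

Definition odd_edge (a b : odd_vertex) : bool := odd_arc a b || odd_arc b a.

Definition odd_weight (a : odd_vertex) : nat :=
  match a with
  | inl (inl _) => q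
  | inr (inr _) => (q - r) * n
  | _ => r
  end.

Definition odd_first (a : odd_vertex) : bool := if a is inl (inl _) then true else false.

(** On the cycle, [v] and [s] of the same index have complementary arcs; types [s] and [l] divide
    the further colors between them. Every vertex receives [q] colors, hence measure one when a
    color has length [1 / q]. *)
Definition odd_color (a : odd_vertex) (b : 'I_n + 'I_q) : bool :=
  match a, b with
  | inl (inl t), inl i => r <= cdiff n i t
  | inl (inr t), inl i => cdiff n i t < r
  | inl (inr t), inr x => x < q - r
  | inr (inl j), inl i => cdiff n i j < q - r
  | inr (inl j), inr x => q - r <= x
  | inr (inr _), inr _ => true
  | _, _ => false
  end.

Definition odd_root_color (b : 'I_n + 'I_q) : bool := if b is inr _ then true else false.

Lemma odd_color_arc a b x : odd_arc a b -> ~~ (odd_color a x && odd_color b x).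
Proof.
have nE : n = q + r := erefl.
case: a => [[t|t]|[t|[]]]; case: b => [[j|j]|[j|[]]]; case: x => [i|x] //=.
- by move=> /eqP <-; rewrite leqNgt; case: (_ < r).
(* The two distances add up to less than [r], as [(q - r) + (2 * r - q) = r]. *)
- move=> h; apply/negP => /andP[+ hi]; rewrite (cdiff_add i j t) modn_small; lia.
- by rewrite andbF.
(* The sum is at least [r], and it stays below [n] because [(q - r) + 2 * r = n]. *)
- move=> h; apply/negP => /andP[+ hi]; rewrite (cdiff_add i j t) modn_small; lia.
- by move=> _; apply/negP => /andP[]; lia.
Qed.

Lemma odd_color_edge a b x : odd_edge a b -> ~~ (odd_color a x && odd_color b x).
Proof.
case/orP=> h; first exact: odd_color_arc.
by rewrite andbC; apply: odd_color_arc.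
Qed.

Lemma odd_root_edge a x : odd_first a -> ~~ (odd_color a x && odd_root_color x).
Proof. by case: a => [[t|t]|[t|[]]] //; case: x => // *; rewrite andbF. Qed.

Lemma odd_edge_sym a b : odd_edge a b = odd_edge b a.
Proof. exact: orbC. Qed.

Lemma odd_edge_first a b : odd_first a -> odd_first b -> ~~ odd_edge a b.
Proof. by case: a => [[t|t]|[t|[]]] //; case: b => [[t'|t']|[t'|[]]]. Qed.

Lemma card_odd_color a : #|[pred x | odd_color a x]| = q.
Proof.
have rn : r < n by rewrite /n; lia.
rewrite -sum1_card big_sumType /= !sum1_card.
have arc (t : 'I_n) s : s <= n -> #|[pred i : 'I_n | cdiff n i t < s]| = s.
  by move=> /(card_arcl t); rewrite cardsE.
have lt s : s <= q -> #|[pred x : 'I_q | x < s]| = s.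
  by move=> /card_ord_lt; rewrite cardsE.
have comp (T : finType) (P : pred T) : #|[pred x | ~~ P x]| = #|T| - #|P|.
  by rewrite -(cardC P) addKn.
have no (T : finType) : #|[pred x : T | false]| = 0 by apply: eq_card0.
case: a => [[t|t]|[t|[]]] /=.
- rewrite no (eq_card (B := [pred i : 'I_n | ~~ (cdiff n i t < r)])); last by move=> i; rewrite !unfold_in /= leqNgt.
  rewrite comp card_ord arc; rewrite /n; lia.
- by rewrite arc ?lt; lia.
- rewrite arc; last by rewrite /n; lia.
  rewrite (eq_card (B := [pred x : 'I_q | ~~ (x < q - r)])); last by move=> x; rewrite !unfold_in /= leqNgt.
  rewrite comp card_ord lt; lia.
- by rewrite no card_ord.
Qed.

Lemma card_odd_root : #|[pred x | odd_root_color x]| = q.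
Proof. by rewrite -sum1_card big_sumType /= big_pred0 // sum1_card card_ord. Qed.

Lemma sum_odd_weight (I : pred odd_vertex) : \sum_(a | I a) odd_weight a =
  q * #|[set t : 'I_n | I (inl (inl t))]| + r * #|[set t : 'I_n | I (inl (inr t))]| +
  r * #|[set t : 'I_n | I (inr (inl t))]| + I (inr (inr tt)) * ((q - r) * n).
Proof.
rewrite !big_sumType /= !sum_nat_const !cardsE ![_ * q]mulnC ![_ * r]mulnC -!addnA.
congr (_ + (_ + (_ + _ * _))).
rewrite -sum1_card big_mkcond /= (bigD1 tt) //= big1 ?addn0; last by case.
by rewrite unfold_in; case: (I _).
Qed.

(** Let [V], [S], [L] be the index sets of the three types in [I], and [U], [D] the indices of the
    neighbours of [L] of types [v] and [s]. Then [V] avoids [U] and [S], and [S] avoids [D], so the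
    bound rests on how fast [U] and [D] grow with [L]. *)
Lemma odd_stable (I : pred odd_vertex) :
  (forall a b, I a -> I b -> ~~ odd_edge a b) -> \sum_(a | I a) odd_weight a <= q * n.
Proof.
move=> stI; rewrite sum_odd_weight.
set V := [set t | _]; set S := [set t | I (inl (inr t))]; set L := [set t | I (inr (inl t))].
have cn (A : {set 'I_n}) : #|A| <= n by rewrite -[leqRHS]card_ord max_card.
set D := [set t : 'I_n | [exists j in L, r <= cdiff n j t <= 2 * r]].
set U := below (2 * r - q) L.
have SD : #|S| + #|D| <= n.
  have : S \subset ~: D.
    apply/subsetP => t; rewrite !inE => tS; apply/negP => /existsP[j /andP[]].
    rewrite inE => jL h; have := stI _ _ tS jL; by rewrite /odd_edge /= h.
  move=> /subset_leq_card; have := cardsC D; rewrite card_ord; lia.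
have VU : V \subset ~: U.
  apply/subsetP => t; rewrite !inE => tV; apply/negP => /existsP[j /andP[]].
  rewrite inE => jL h; have := stI _ _ tV jL; by rewrite /odd_edge /= h.
have VS : #|V| + #|S :\: U| + #|U| <= n.
  have : V :|: (S :\: U) \subset ~: U.
    by rewrite subUset VU /=; apply/subsetP => t; rewrite !inE => /andP[].
  move=> /subset_leq_card; have := cardsC U; rewrite card_ord cardsU.
  have -> : V :&: (S :\: U) = set0.
    apply/setP => t; rewrite !inE; apply/negP => /and3P[tV _ tS].
    by have := stI _ _ tV tS; rewrite /odd_edge /= eqxx.
  rewrite cards0; lia.
have SU : #|S :\: U| + #|S :&: U| = #|S| by rewrite addnC cardsID.
have SU' : #|S :&: U| <= #|U| by apply/subset_leq_card/subsetIr.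
have cL := cn L.
have V0 : I (inr (inr tt)) -> #|V| = 0.
  move=> hu; apply: eq_card0 => t; rewrite inE; apply/negP => tV.
  by have := stI _ _ tV hu.
have [L0|L0] := eqVneq L set0.
  rewrite L0 cards0.
  move: V0 VS SU SU' (cn S); case: (I _) => [/(_ isT)|_] /=; 
  move: #|V| #|S| #|U| #|_| #|_| => *; subst; nia.
have := card_between L0; have := card_below (2 * r - q) L0.
rewrite -/U -/D.
move: V0 VS SU SU' (cn S) SD cL (max_card U) (max_card D); rewrite card_ord.
move: #|V| #|S| #|U| #|L| #|D| #|S :\: U| #|S :&: U| => v s u c d b s2.
(* The vertex of large weight excludes all of [V]. Then [s + c <= n] because [D] is at least as
   large as [L], and the weights [r] and [q - r] add up to [q]. *)
case: (I _) => [/(_ isT) v0|_] VS SU SU' sn SD cn' un dn hu hd /=.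
  rewrite v0 muln0 add0n mul1n -mulnDr.
  have : s + c <= n by lia.
  move=> /(leq_mul (leqnn r)) h; apply: leq_trans (leq_add h (leqnn _)) _.
  by rewrite -mulnDl subnKC // ltnW.
rewrite mul0n addn0; move: sn SD; rewrite -{}SU => sn SD.
have nE : n = q + r := erefl; move: (n) nE VS sn SD cn' un dn hu hd => N -> {stI cn} *.
have [cq|cq] := leqP c (q - r).
  have ub : c + (2 * r - q) <= u by lia.
  (* Bounding [s2] by [u] leaves this inequality, which follows from
     [(2 * r - q) * (q - r - c) >= 0]. *)
  suff : r * c <= (q - r) * u by nia.
  nia.
(* In the middle range [S] has at most [q - c] elements, so [S] and [L] weigh at most [r * q] and
   [V] at most [q * q]. Beyond it [D] is the whole cycle and [S] is empty. *)
have [cq'|cq'] := leqP c q.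
  have : r <= u by lia.
  have : b + s2 <= q - c by lia.
  move=> h1 h2; have : v <= q by lia.
  nia.
have : c <= u by lia.
have : b + s2 = 0 by lia.
nia.
Qed.

End OddGadget.

(** * Packing and pieces of equal length *)

HB.instance Definition _ := Monoid.isComLaw.Build R 0 Rplus
  (fun x y z => esym (Rplus_assoc x y z)) Rplus_comm Rplus_0_l.

Lemma INR_sum (T : Type) (s : seq T) (P : pred T) (F : T -> nat) :
  INR (\sum_(t <- s | P t) F t) = \big[Rplus/0]_(t <- s | P t) INR (F t).
Proof. by apply: (big_morph INR) => //; apply: plus_INR. Qed.

Lemma big_Rmult_l (T : Type) (s : seq T) (P : pred T) (F : T -> R) c :
  c * \big[Rplus/0]_(t <- s | P t) F t = \big[Rplus/0]_(t <- s | P t) (c * F t).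
Proof. by apply: (big_morph (Rmult c)) => [x y|]; ring. Qed.

Lemma big_Rle (T : Type) (s : seq T) (P : pred T) (F G : T -> R) :
  (forall t, P t -> F t <= G t) ->
  \big[Rplus/0]_(t <- s | P t) F t <= \big[Rplus/0]_(t <- s | P t) G t.
Proof.
move=> H; elim/big_rec2: _ => [|t x y Pt h]; first lra.
by have := H t Pt; lra.
Qed.

Lemma big_Rconst (T : finType) (P : pred T) (c : R) :
  \big[Rplus/0]_(t | P t) c = INR #|P| * c.
Proof.
rewrite -sum1_card INR_sum Rmult_comm big_Rmult_l.
by apply: eq_bigr => t _ /=; ring.
Qed.

Definition indic (A : RSet) (x : R) : bool :=
  if excluded_middle_informative (A x) then true else false.

Lemma indicP (A : RSet) x : reflect (A x) (indic A x).
Proof. by rewrite /indic; case: excluded_middle_informative => h; constructor. Qed.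

(** The integral over [E] of a pointwise weight bound, proved without integrals: the first set
    splits [E], and inside it the capacity [M] drops by the weight of that set. *)
Lemma weighted_packing (T : Type) (z : T -> nat) (C : T -> RSet) (s : seq T) :
  (forall t, meas (C t)) -> forall (E : RSet) (M : nat), fin E ->
  (forall x, E x -> (\sum_(t <- s | indic (C t) x) z t <= M)%N) ->
  \big[Rplus/0]_(t <- s) (INR (z t) * mu (fun x => E x /\ C t x)) <= INR M * mu E.
Proof.
move=> MC; elim: s => [|t s IHs] E M FE HM.
  by rewrite big_nil; apply: Rmult_le_pos; [apply: pos_INR|apply: mu_ge0].
have F1 : fin (fun x => E x /\ C t x) by apply: fin_sub FE => x [].
have F2 : fin (fun x => E x /\ ~ C t x) by apply: fin_sub FE => x [].
have H1 : INR (z t) * mu (fun x => E x /\ C t x) +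
    \big[Rplus/0]_(u <- s) (INR (z u) * mu (fun x => (E x /\ C t x) /\ C u x))
    <= INR M * mu (fun x => E x /\ C t x).
  have [ztM|Mzt] := leqP (z t) M.
    have := IHs _ (M - z t)%N F1.
    have -> : INR (M - z t) = INR M - INR (z t) by rewrite minus_INR //; apply/leP.
    move=> H; suff : forall x, E x /\ C t x ->
      (\sum_(u <- s | indic (C u) x) z u <= M - z t)%N by move=> /H; lra.
    move=> x [Ex Cx]; have := HM x Ex; rewrite big_cons.
    by case: indicP => // _; rewrite leq_subRL.
  (* A weight above [M] forces this part to be empty; the truncated difference [M - z t] would not
     serve here. *)
  have E0 x : ~ (E x /\ C t x).
    case=> Ex Cx; have := HM x Ex; rewrite big_cons; case: indicP => // _.
    by rewrite leqNgt (leq_trans Mzt) ?leq_addr.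
  rewrite (mu_empty _ E0) big1; first lra.
  move=> u _; rewrite mu_empty; first lra.
  by move=> x [/E0].
have H2 : \big[Rplus/0]_(u <- s) (INR (z u) * mu (fun x => (E x /\ ~ C t x) /\ C u x))
    <= INR M * mu (fun x => E x /\ ~ C t x).
  apply: IHs => // x [Ex Cx]; have := HM x Ex; rewrite big_cons.
  by case: indicP.
rewrite big_cons (mu_split _ _ (MC t) FE) Rmult_plus_distr_l.
apply: Rle_trans (Rplus_le_compat _ _ _ _ H1 H2); apply: Req_le.
rewrite Rplus_assoc -big_split; congr (_ + _); apply: eq_bigr => u _ /=.
rewrite -Rmult_plus_distr_l; congr (_ * _).
rewrite (@mu_split (C t) (fun x => E x /\ C u x)) //; last by apply: fin_sub FE => x [].
by congr (_ + _); apply: mu_ext => x; tauto.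
Qed.

Lemma mu_disjoint_union (T : eqType) (D : T -> RSet) (s : seq T) (E : RSet) :
  (forall t, meas (D t)) -> (forall t u x, D t x -> D u x -> t = u) -> fin E -> uniq s ->
  mu (fun x => E x /\ exists t, t \in s /\ D t x) =
  \big[Rplus/0]_(t <- s) mu (fun x => E x /\ D t x).
Proof.
move=> MD dis FE; elim: s => [|t s IHs] /=.
  by move=> _; rewrite big_nil; apply: mu_empty => x [_ [? []]].
case/andP=> ts us; rewrite big_cons -IHs //.
rewrite (@mu_split (D t)) //; last by apply: fin_sub FE => x [].
congr (_ + _); apply: mu_ext => x; split.
- by case=> -[].
- by case=> Ex Dx; split=> //; split=> //; exists t; rewrite mem_head.
- case=> -[Ex [u [+ Du]]] nDt; rewrite inE => /orP[/eqP ut|us']; first by case: nDt; rewrite -ut.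
  by split=> //; exists u.
- case=> Ex [u [us' Du]]; split; last first.
    by move=> Dt; move: ts; rewrite (dis _ _ _ Dt Du) us'.
  by split=> //; exists u; rewrite inE us' orbT.
Qed.

(** * Finite colorings realised by intervals *)

Section Pieces.
Variables (B : finType) (Q : nat).
Hypothesis Q_gt0 : (0 < Q)%N.

(** A color of a finite palette becomes an interval of length [1 / Q], so that [Q] colors have
    measure one. *)
Definition piece (b : B) : RSet :=
  fun x => INR (enum_rank b) / INR Q <= x < INR (enum_rank b).+1 / INR Q.

Definition pieces (F : pred B) : RSet := fun x => exists b, b \in enum F /\ piece b x.

Lemma INR_Q_gt0 : 0 < INR Q. Proof. by apply: lt_0_INR; apply/ltP. Qed.

Lemma piece_meas b : meas (piece b). Proof. exact: meas_ico. Qed.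

Lemma INR_div_le (i : nat) (x : R) : (INR i / INR Q <= x) <-> (INR i <= x * INR Q).
Proof.
have q0 := INR_Q_gt0; split=> h.
  by rewrite -(Rmult_1_r (INR i)) -(Rinv_l (INR Q)); [rewrite -Rmult_assoc; apply: Rmult_le_compat_r h; lra|lra].
apply: (Rmult_le_reg_r (INR Q)) => //.
by rewrite /Rdiv Rmult_assoc Rinv_l; lra.
Qed.

Lemma pieceE b x : piece b x <-> INR (enum_rank b) <= x * INR Q < INR (enum_rank b) + 1.
Proof.
have h1 := INR_div_le (enum_rank b) x; have h2 := INR_div_le (enum_rank b).+1 x.
by rewrite /piece -S_INR; split=> -[u v]; split; (try by apply/h1);
  apply: Rnot_le_lt => /h2; lra.
Qed.

Lemma piece_disjoint t u x : piece t x -> piece u x -> t = u.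
Proof.
rewrite !pieceE => h1 h2; apply: enum_rank_inj; apply: ord_inj.
move: h1 h2; move: (nat_of_ord _) (nat_of_ord _) => i j h1 h2.
have le (a b : nat) : INR a < INR b + 1 -> (a <= b)%N.
  by rewrite -S_INR => /INR_lt /ltP.
by apply/eqP; rewrite eqn_leq !le //; lra.
Qed.

Lemma piece_cover x : 0 <= x < INR #|B| / INR Q -> exists b, piece b x.
Proof.
case=> x0 xB; have {}xB : x * INR Q < INR #|B|.
  by apply: Rnot_le_lt => /INR_div_le; lra.
have {}x0 : 0 <= x * INR Q by apply: Rmult_le_pos => //; apply: pos_INR.
have [i [iB hi]] : exists i, (i < #|B|)%N /\ INR i <= x * INR Q < INR i + 1.
  move: (x * INR Q) x0 xB => y; elim: #|B| => [|m IHm] y0 ym; first by move: ym => /=; lra.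
  have [h|h] := Rlt_or_le y (INR m).
    by have [i [im hi]] := IHm y0 h; exists i; split=> //; apply: leqW.
  by exists m; split=> //; move: ym; rewrite S_INR; lra.
by exists (enum_val (Ordinal iB)); rewrite pieceE enum_valK.
Qed.

Lemma mu_pieces (F : pred B) (E : RSet) : fin E ->
  mu (fun x => E x /\ pieces F x) = \big[Rplus/0]_(b | F b) mu (fun x => E x /\ piece b x).
Proof.
move=> FE; rewrite /pieces mu_disjoint_union ?enum_uniq //; first by rewrite big_enum.
  exact: piece_meas.
exact: piece_disjoint.
Qed.

Lemma pieces_inside F : inside (INR #|B| / INR Q) (pieces F).
Proof.
have q0 := INR_Q_gt0.
move=> x [b [_ [h1 h2]]]; split.
  by apply: Rle_trans h1; apply: Rle_mult_inv_pos => //; apply: pos_INR.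
apply: Rlt_le_trans h2 _; apply: Rmult_le_compat_r; first by apply/Rlt_le/Rinv_0_lt_compat.
by apply: le_INR; apply/leP; apply: ltn_ord.
Qed.

Lemma pieces_meas F : meas (pieces F).
Proof.
rewrite /pieces; elim: (enum F) => [|b s IHs].
  by apply: meas_ext meas_empty => x; split=> // -[? []].
apply: meas_ext (meas_or _ _ (piece_meas b) IHs) => x; split.
  case=> [h|[u [us h]]]; first by exists b; rewrite mem_head.
  by exists u; rewrite inE us orbT.
by case=> u [+ h]; rewrite inE => /orP[/eqP <-|us]; [left|right; exists u].
Qed.

Lemma mu_pieces_card F : mu (pieces F) = INR #|F| / INR Q.
Proof.
have q0 := INR_Q_gt0.
have -> : mu (pieces F) = mu (fun x => 0 <= x < INR #|B| / INR Q /\ pieces F x).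
  by apply: mu_ext => x; split=> [h|[]//]; split=> //; apply: pieces_inside h.
rewrite mu_pieces; last exact: fin_ico.
rewrite (eq_bigr (fun _ => / INR Q)) ?big_Rconst // => b _.
rewrite (@mu_ext _ (piece b)).
  rewrite mu_ico; first by rewrite S_INR; field; lra.
  apply: Rmult_le_compat_r; first by apply/Rlt_le/Rinv_0_lt_compat.
  by rewrite S_INR; lra.
move=> x; split=> [[]//|h]; split=> //.
by apply: (@pieces_inside predT); exists b; rewrite mem_enum.
Qed.

Lemma pieces_disjoint F G : (forall b, ~~ (F b && G b)) -> forall x, ~ (pieces F x /\ pieces G x).
Proof.
move=> H x [[b [+ hb]] [c [+ hc]]]; rewrite !mem_enum => Fb.
by rewrite -(piece_disjoint hb hc) => Gb; have := H b; rewrite /in_mem /= in Fb Gb *; rewrite Fb Gb.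
Qed.

Lemma unit_pieces F : #|F| = Q -> unit_color_set (INR #|B| / INR Q) (pieces F).
Proof.
move=> FQ; apply/unit_color_setE; split; first exact: pieces_inside.
split; first exact: pieces_meas.
by have q0 := INR_Q_gt0; rewrite mu_pieces_card FQ; field; lra.
Qed.

End Pieces.

(** * Lower bound *)

Section FiniteGraph.
Variables (T : finType) (e : rel T).

Definition code (a : T) : nat := enum_rank a.
Definition nat_adj (u v : nat) : Prop := exists a b, [/\ u = code a, v = code b & e a b].

Lemma code_inj : injective code.
Proof. by move=> a b /ord_inj /enum_rank_inj. Qed.

Lemma nat_adjE a b : nat_adj (code a) (code b) <-> e a b.
Proof. by split=> [[a' [b' [/code_inj -> /code_inj ->]]]//|h]; exists a, b. Qed.

Lemma code_lt a : (code a < #|T|)%coq_nat.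
Proof. by apply/ltP/ltn_ord. Qed.

Lemma code_surj u : (u < #|T|)%coq_nat -> exists a, u = code a.
Proof. by move=> /ltP h; exists (enum_val (Ordinal h)); rewrite /code enum_valK. Qed.

Lemma simple_nat_adj : symmetric e -> irreflexive e -> simple_graph #|T| nat_adj.
Proof.
move=> sym irr; split; [|split].
- by move=> u v [a [b [-> -> _]]]; split; apply: code_lt.
- by move=> u v [a [b [-> -> h]]]; exists b, a; rewrite sym.
- move=> u [a [b [-> /code_inj <-]]]; by rewrite irr.
Qed.

(** A potential rising by at most one along each edge bounds walk lengths from below; it is applied
    to [depth] to separate the roots. *)
Lemma walk_lipschitz (d : T -> nat) :
  (forall a b, e a b -> (d b <= (d a).+1)%N) ->
  forall u v l, walk nat_adj u v l -> forall a b, u = code a -> v = code b -> (d b <= d a + l)%N.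
Proof.
move=> H u v l; elim=> {u v l} [u|u w v l [a' [c [-> -> ac]]] _ IH] a b.
  by move=> -> /code_inj ->; rewrite addn0.
move=> /code_inj <- vb; have := IH _ _ erefl vb; have := H _ _ ac; lia.
Qed.

End FiniteGraph.

(** * Copies of a gadget attached to shared twins *)

Section LowerBound.
Variables (k : R) (T : finType) (e : rel T) (first : pred T) (z : T -> nat) (M : nat).
Variables (phi : T -> RSet) (phi0 : RSet).
Hypothesis M_gt0 : (0 < M)%N.
Hypothesis e_sym : symmetric e.
Hypothesis e_irr : irreflexive e.
Hypothesis e_first : forall a b, first a -> first b -> ~~ e a b.
Hypothesis z_first : (\sum_(a | first a) z a)%N = M.
Hypothesis z_sum : INR (\sum_a z a) = INR M * k.
Hypothesis z_stable : forall I : pred T,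
  (forall a b, I a -> I b -> ~~ e a b) -> (\sum_(a | I a) z a <= M)%N.
Hypothesis phi_unit : forall a, unit_color_set k (phi a).
Hypothesis phi0_unit : unit_color_set k phi0.
Hypothesis phi_edge : forall a b, e a b -> forall x, ~ (phi a x /\ phi b x).
Hypothesis phi_first : forall a, first a -> forall x, ~ (phi a x /\ phi0 x).

Variables P Q : nat.
Hypothesis Q_gt0 : (0 < Q)%N.
Hypothesis QP : (Q <= P)%N.

(* [(Some i, None)] is the precolored root of the [i]-th copy of the gadget,
   [(None, Some a)] a twin of the vertex [a], shared by all copies. *)
Let V := (option 'I_P * option T)%type.

(** A twin of [b] in [first] is joined, in every copy, to the neighbours of [b] outside [first]. It
    can thus replace [b] in independent sets while not being adjacent to any root. *)
Definition spider_arc (u v : V) : bool :=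
  match u, v with
  | (Some i, Some a), (Some j, Some b) => (i == j) && e a b
  | (Some i, None), (Some j, Some b) => (i == j) && first b
  | (Some i, Some a), (None, Some b) => [&& ~~ first a, first b & e a b]
  | _, _ => false
  end.

Definition spider (u v : V) : bool := spider_arc u v || spider_arc v u.

Lemma spider_sym : symmetric spider.
Proof. by move=> u v; rewrite /spider orbC. Qed.

Lemma spider_irr : irreflexive spider.
Proof. by move=> [[i|] [a|]] //; rewrite /spider /= ?e_irr ?andbF. Qed.

Definition is_root (u : nat) : Prop := exists i : 'I_P, u = code ((Some i, None) : V).

(** The levels on the way from root [i] to another root: its neighbours, the rest of its copy, the
    twins, then another copy in reverse order. *)
Definition depth (i : 'I_P) (u : V) : nat :=
  (match u with
  | (Some j, None) => if j == i then 0 else 6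
  | (Some j, Some a) => if j == i then (if first a then 1 else 2) else (if first a then 5 else 4)
  | (None, _) => 3
  end)%N.

Lemma depth_step i u v : spider u v -> (depth i v <= (depth i u).+1)%N.
Proof.
rewrite /spider => /orP[]; move: u v => [[j|] [a|]] [[j'|] [b|]] //=.
- by move=> /andP[/eqP -> _]; case: (_ == _); case: (first a); case: (first b).
- by case/and3P=> /negbTE -> _ _; case: (_ == _).
- by case/andP=> /eqP -> ->; case: (_ == _).
- by move=> /andP[/eqP -> _]; case: (_ == _); case: (first a); case: (first b).
- by case/andP=> /eqP -> ->; case: (_ == _).
- by case/and3P=> /negbTE -> _ _; case: (_ == _).
Qed.

Lemma roots_far : far_apart (nat_adj spider) is_root 6.
Proof.
move=> u v [i ->] [j ->] ij l /ltP l6 /(walk_lipschitz (@depth_step i)).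
move=> /(_ _ _ erefl erefl) /=; rewrite eqxx.
have /negbTE -> : j != i by apply: contra_not_neq ij => ->.
by rewrite add0n leqNgt l6.
Qed.

Definition spider_color (u : V) : RSet := if u.2 is Some a then phi a else phi0.

Lemma spider_colorable : frac_colorable #|{: V}| (nat_adj spider) k.
Proof.
exists (fun u x => exists a : V, u = code a /\ spider_color a x); split.
  move=> u /code_surj[a ->].
  have -> : (fun x => exists b : V, code a = code b /\ spider_color b x) = spider_color a.
    apply: functional_extensionality => x; apply: propositional_extensionality.
    by split=> [[b [/code_inj <-]]//|h]; exists a.
  by case: a => i [a|]; [apply: phi_unit|apply: phi0_unit].
move=> _ _ [u [v [-> -> uv]]] x [[u' [/code_inj <- hu]] [v' [/code_inj <- hv]]].
move: u v uv hu hv => [[j|] [a|]] [[j'|] [b|]] //; rewrite /spider /spider_color //= ?orbF.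
- by rewrite [e b a]e_sym [j' == j]eq_sym orbb => /andP[_ /phi_edge h] h1 h2; case: (h x).
- by move=> /andP[_ /phi_first h] h1 h2; case: (h x).
- by case/and3P=> _ _ /phi_edge h h1 h2; case: (h x).
- by move=> /andP[_ /phi_first h] h1 h2; case: (h x).
- by case/and3P=> _ _ /phi_edge h h1 h2; case: (h x).
Qed.

Let m := INR P / INR Q.

(* Every point of [[0, m)] lies in exactly [Q] of these [P] sets. *)
Definition root_arc (i : 'I_P) : RSet :=
  pieces Q (fun j : 'I_P => cdiff P j i < Q)%N.

Lemma root_arc_unit i : unit_color_set m (root_arc i).
Proof.
have h := @unit_pieces 'I_P Q Q_gt0; rewrite card_ord in h; apply: h.
by rewrite -[RHS](card_arcl i QP) cardsE.
Qed.

(** Double counting: the piece of index [j] belongs to the [Q] arcs that start fewer than [Q] steps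
    behind [j]. *)
Lemma sum_root_arc (E : RSet) : inside m E ->
  \big[Rplus/0]_(i < P) mu (fun x => E x /\ root_arc i x) = INR Q * mu E.
Proof.
move=> inE; have FE := inside_fin _ _ inE.
rewrite (eq_bigr (fun i : 'I_P => \big[Rplus/0]_(j : 'I_P | (cdiff P j i < Q)%N)
   mu (fun x => E x /\ piece Q j x))); last by move=> i _; apply: mu_pieces.
rewrite (exchange_big_dep predT) //=.
rewrite (eq_bigr (fun j : 'I_P => INR Q * mu (fun x => E x /\ piece Q j x))); last first.
  move=> j _; rewrite (big_Rconst (fun i : 'I_P => cdiff P j i < Q)%N); congr (INR _ * _).
  by rewrite -[RHS](card_arcr j QP) cardsE.
rewrite -big_Rmult_l; congr (_ * _); rewrite -(@mu_pieces 'I_P Q Q_gt0 predT) //.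
apply: mu_ext => x; split=> [[]//|Ex]; split=> //.
have [|b hb] := @piece_cover 'I_P Q Q_gt0 x; first by rewrite card_ord; apply: inE.
by exists b; rewrite mem_enum.
Qed.

Lemma spider_bound (eps : R) : k + eps = m -> ext_property k 6 eps -> k + INR Q / INR P <= m.
Proof.
move=> km ext.
have q0 : 0 < INR Q by apply: lt_0_INR; apply/ltP.
have p0 : 0 < INR P by apply: lt_0_INR; apply/ltP; apply: leq_trans QP.
have m0 : 0 < m by apply: Rdiv_lt_0_compat.
have M0 : 0 < INR M by apply: lt_0_INR; apply/ltP.
pose p u : RSet := fun x => exists i : 'I_P, u = code ((Some i, None) : V) /\ root_arc i x.
have pE i : p (code ((Some i, None) : V)) = root_arc i.
  apply: functional_extensionality => x; apply: propositional_extensionality.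
  by split=> [[j [/code_inj [<-]]]//|h]; exists i.
have [||c [[cU cD] cp]] := ext _ _ (simple_nat_adj spider_sym spider_irr) spider_colorable
   is_root _ roots_far p _.
- by move=> _ [i ->]; apply: code_lt.
- by move=> _ [i ->]; rewrite pE km; apply: root_arc_unit.
rewrite km in cU.
pose col (u : V) := c (code u).
have colU u : [/\ inside m (col u), meas (col u) & mu (col u) = 1].
  by have /unit_color_setE[? [? ?]] := cU _ (code_lt u).
have colD u v x : spider u v -> col u x -> col v x -> False.
  by move=> uv h1 h2; apply: (cD (code u) (code v)) (conj h1 h2); apply/nat_adjE.
have colR i x : root_arc i x -> col (Some i, None) x.
  by rewrite -pE => h; apply/cp => //; exists i.
have unit_root i : [/\ inside m (root_arc i), meas (root_arc i) & mu (root_arc i) = 1].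
  by have /unit_color_setE[? [? ?]] := root_arc_unit i.
pose Y a := col (None, Some a).
have copy i : INR M * k +
    \big[Rplus/0]_(a | first a) (INR (z a) * mu (fun x => Y a x /\ root_arc i x)) <= INR M * m.
  have [inA MA EA] := unit_root i; have FA := inside_fin _ _ inA.
  pose H a := col (Some i, Some a).
  (* On the root color the vertices of [first] in the copy have no points, so their place in the
     packing is free for the twins. *)
  pose J a := if first a then Y a else H a.
  have FH a : fin (H a) by have [h _ _] := colU (Some i, Some a); apply: inside_fin h.
  have onA : \big[Rplus/0]_a (INR (z a) * mu (fun x => root_arc i x /\ J a x)) <= INR M * 1.
    rewrite -EA; apply: weighted_packing => [a|//|x Ax].
      by rewrite /J; case: ifP => _; [have [] := colU (None, Some a)|have [] := colU (Some i, Some a)].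
    apply: z_stable => a b /indicP Ja /indicP Jb; apply/negP => eab.
    move: Ja Jb; rewrite /J; case: ifP => fa; case: ifP => fb.
    - by move: (e_first fa fb); rewrite eab.
    - by apply: (@colD (None, Some a) (Some i, Some b)); rewrite /spider /= fa fb e_sym eab.
    - by apply: (@colD (Some i, Some a) (None, Some b)); rewrite /spider /= fa fb eab.
    - by apply: (@colD (Some i, Some a) (Some i, Some b)); rewrite /spider /= eqxx eab.
  pose A' x := 0 <= x < m /\ ~ root_arc i x.
  have EA' : mu A' = m - 1.
    have := mu_split (root_arc i) (fun x => 0 <= x < m) MA (fin_ico _ _).
    rewrite mu_ico ?(mu_ext (fun x => 0 <= x < m /\ root_arc i x) (root_arc i)) ?EA.
    - by rewrite /A'; lra.
    - by move=> x; split=> [[]//|h]; split=> //; apply: inA.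
    - lra.
  have offA : \big[Rplus/0]_a (INR (z a) * mu (fun x => A' x /\ H a x)) <= INR M * (m - 1).
    rewrite -EA'; apply: weighted_packing => [a||x Ax].
    - by have [] := colU (Some i, Some a).
    - by apply: fin_sub (fin_ico 0 m) => x [].
    apply: z_stable => a b /indicP Ja /indicP Jb; apply/negP => eab.
    by apply: (@colD (Some i, Some a) (Some i, Some b)) Ja Jb; rewrite /spider /= eqxx eab.
  have HA' a : mu (H a) = mu (fun x => root_arc i x /\ H a x) + mu (fun x => A' x /\ H a x).
    rewrite (mu_split (root_arc i) (H a) MA (FH a)); congr (_ + _); apply: mu_ext => x.
      by tauto.
    have [inH _ _] := colU (Some i, Some a); have := inH x; rewrite /A' -/(H a); tauto.
  have first0 a : first a -> mu (fun x => root_arc i x /\ H a x) = 0.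
    move=> fa; apply: mu_empty => x [/colR h1 h2].
    by apply: (@colD (Some i, None) (Some i, Some a)) h1 h2; rewrite /spider /= eqxx fa.
  have total : INR M * k = \big[Rplus/0]_a (INR (z a) * mu (H a)).
    rewrite -z_sum INR_sum; apply: eq_bigr => a _.
    by have [_ _ ->] := colU (Some i, Some a); rewrite Rmult_1_r.
  suff : INR M * k + \big[Rplus/0]_(a | first a) (INR (z a) * mu (fun x => Y a x /\ root_arc i x))
    = \big[Rplus/0]_a (INR (z a) * mu (fun x => root_arc i x /\ J a x)) +
      \big[Rplus/0]_a (INR (z a) * mu (fun x => A' x /\ H a x)) by move: onA offA; lra.
  rewrite total [X in _ + X]big_mkcond -!big_split; apply: eq_bigr => a _ /=.
  rewrite HA' /J; case: ifP => fa; last by ring.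
  rewrite first0 // (mu_ext (fun x => Y a x /\ root_arc i x) (fun x => root_arc i x /\ Y a x)).
    by ring.
  by move=> x; tauto.
(* Over all [P] copies a twin meets the arcs in total measure [Q], and [first] has weight [M];
   dividing by [P * M] gives the claim. *)
have : \big[Rplus/0]_(i < P) (INR M * k +
    \big[Rplus/0]_(a | first a) (INR (z a) * mu (fun x => Y a x /\ root_arc i x)))
   <= \big[Rplus/0]_(i < P) (INR M * m) by apply: big_Rle.
rewrite big_split /= exchange_big /= !(@big_Rconst 'I_P predT) card_ord.
rewrite (eq_bigr (fun a => INR Q * INR (z a))); last first.
  move=> a _; rewrite -big_Rmult_l; have [inY _ EY] := colU (None, Some a).
  by rewrite sum_root_arc // EY; ring.
rewrite -big_Rmult_l -INR_sum z_first => h.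
apply: (Rmult_le_reg_l (INR P * INR M)); first exact: Rmult_lt_0_compat.
apply: Rle_trans (_ : INR P * (INR M * k) + INR Q * INR M <= _); last by lra.
by apply: Req_le; field; lra.
Qed.

End LowerBound.

(** * The two gadgets and the value of the infimum *)

Lemma edge_gadget_bound (P Q : nat) (eps : R) : (0 < Q)%N -> (Q <= P)%N ->
  2 + eps = INR P / INR Q -> ext_property 2 6 eps -> 2 + INR Q / INR P <= INR P / INR Q.
Proof.
move=> Q0 QP; have k2 : INR #|{: bool}| / INR 1 = 2 by rewrite card_bool /=; field.
(* The gadget is an edge with unit weights; [first] consists of [true], and the root is colored like
   the other end. *)
apply: (@spider_bound 2 bool (fun a b => a != b) id (fun=> 1%N) 1
  (fun a => pieces 1 (pred1 a)) (pieces 1 (pred1 false))) => //.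
- by move=> a b; rewrite eq_sym.
- by move=> a; rewrite eqxx.
- by move=> [] [].
- by rewrite big_mkcond big_bool.
- by rewrite big_bool /=; ring.
- move=> I HI; rewrite big_mkcond big_bool; have := HI true false.
  by case: (I true) => //; case: (I false) => // /(_ isT isT).
- by move=> a; rewrite -k2; apply: unit_pieces => //; apply: card1.
- by rewrite -k2; apply: unit_pieces => //; apply: card1.
- by move=> a b ab; apply: pieces_disjoint => // x; case: a b x ab => [] [] [].
- by move=> a fa; apply: pieces_disjoint => // x; move: fa; case: a => //; case: x.
Qed.

Lemma odd_gadget_bound (q r P Q : nat) (k eps : R) : (q <= 2 * r)%N -> (r < q)%N ->
  k = INR (2 * q + r) / INR q -> (0 < Q)%N -> (Q <= P)%N ->
  k + eps = INR P / INR Q -> ext_property k 6 eps -> k + INR Q / INR P <= INR P / INR Q.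
Proof.
move=> qr rq kE Q0 QP.
have q0 : (0 < q)%N by apply: leq_ltn_trans rq.
have q0' : 0 < INR q by apply: lt_0_INR; apply/ltP.
have kE' : INR #|{: 'I_(q + r) + 'I_q}| / INR q = k.
  by rewrite kE card_sum !card_ord; congr (INR _ / _); lia.
(* [q * (q + r)] is the weight of all vertices of type [v]; the [2 * q + r] intervals of length
   [1 / q] fill [[0, k)]. *)
apply: (@spider_bound k _ (@odd_edge q r) (@odd_first q r) (@odd_weight q r) (q * (q + r))
  (fun a => pieces q (@odd_color q r a)) (pieces q (@odd_root_color q r))) => //.
- by rewrite muln_gt0 q0 addn_gt0 q0.
- exact: odd_edge_sym.
- by case=> [[t|t]|[t|[]]].
- exact: odd_edge_first.
- rewrite (sum_odd_weight (@odd_first q r)) /=.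
  have c0 : #|[set t : 'I_(q + r) | false]| = 0%N by apply: eq_card0 => t; rewrite inE.
  have c1 : #|[set t : 'I_(q + r) | true]| = (q + r)%N.
    by rewrite -[RHS]card_ord; apply: eq_card => t; rewrite inE.
  by rewrite c0 c1; lia.
- rewrite (sum_odd_weight predT) /=.
  have c1 : #|[set t : 'I_(q + r) | true]| = (q + r)%N.
    by rewrite -[RHS]card_ord; apply: eq_card => t; rewrite inE.
  rewrite c1 mul1n kE.
  have -> : (q * (q + r) + r * (q + r) + r * (q + r) + (q - r) * (q + r) =
    (2 * q + r) * (q + r))%N by nia.
  by rewrite !mult_INR; field; lra.
- by move=> I; apply: odd_stable.
- by move=> a; rewrite -kE'; apply: unit_pieces => //; apply: card_odd_color.
- by rewrite -kE'; apply: unit_pieces => //; apply: card_odd_root.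
- by move=> a b ab; apply: pieces_disjoint => // x; apply: odd_color_edge.
- by move=> a fa; apply: pieces_disjoint => // x; apply: odd_root_edge.
Qed.

(** For [k = 2 + r / q] the two bounds on [k] say exactly [q <= 2 * r] and [r < q]. *)
Lemma rational_odd_form (k : R) : is_rational k -> 5 / 2 <= k < 3 ->
  exists q r : nat, [/\ (q <= 2 * r)%N, (r < q)%N & k = INR (2 * q + r) / INR q].
Proof.
case=> p [q [q0 kE]] kr.
have [p' [q' [q0' kE']]] : exists p' q', (0 < q')%Z /\ k = IZR p' / IZR q'.
  case: (Z.lt_total 0 q) => [h|[h|h]]; [by exists p, q|by case: q0|].
  exists (- p)%Z, (- q)%Z; split; first by lia.
  by rewrite kE !opp_IZR; field; apply: not_0_IZR.
have Q0 : 0 < IZR q' by apply: IZR_lt.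
have pE : IZR p' = k * IZR q' by rewrite kE'; field; lra.
have h1 : (5 * q' <= 2 * p')%Z by apply: le_IZR; rewrite !mult_IZR pE; nra.
have h2 : (p' < 3 * q')%Z by apply: lt_IZR; rewrite !mult_IZR pE; nra.
exists (Z.to_nat q'), (Z.to_nat (p' - 2 * q')).
split; [by lia|by lia|].
rewrite kE' !INR_IZR_INZ; congr (IZR _ / IZR _); lia.
Qed.

Lemma rational_between (a b : R) : 0 <= a < b ->
  exists P Q : nat, (0 < Q)%N /\ a < INR P / INR Q < b.
Proof.
move=> [a0 ab]; have [Q [hQ Q0]] := archimed_cor1 (b - a) ltac:(lra).
have Q0' : 0 < INR Q by apply: lt_0_INR.
have [h1 h2] := archimed (a * INR Q).
have aQ : 0 <= a * INR Q by apply: Rmult_le_pos => //; lra.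
have up0 : (0 <= up (a * INR Q))%Z by apply: le_IZR; lra.
(* [up] rounds strictly upwards by at most one, and [1 / Q] is smaller than the gap [b - a]. *)
exists (Z.to_nat (up (a * INR Q))), Q; split; first by apply/ltP.
rewrite (INR_IZR_INZ (Z.to_nat _)) Znat.Z2Nat.id //.
have hQ' : 1 < (b - a) * INR Q.
  by have := Rmult_lt_compat_r _ _ _ Q0' hQ; rewrite Rinv_l; lra.
split; apply: (Rmult_lt_reg_r (INR Q)) => //; rewrite /Rdiv Rmult_assoc Rinv_l; lra.
Qed.

Unset Implicit Arguments.

Theorem mainTheorem2 (k : R) (hk : is_rational k)
  (hrange : k = 2 \/ (5 / 2 <= k /\ k < 3)) :
  g_eq k 6 ((sqrt (k ^ 2 + 4) - k) / 2).
Proof.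
set eps0 := (_ - k) / 2.
have k2 : 2 <= k < 3 by case: hrange; lra.
have s2 : sqrt (k ^ 2 + 4) * sqrt (k ^ 2 + 4) = k ^ 2 + 4 by apply: sqrt_sqrt; nra.
have s0 : 0 <= sqrt (k ^ 2 + 4) by apply: sqrt_pos.
have eps_eq : eps0 * (k + eps0) = 1 by rewrite /eps0; nra.
have eps0_gt0 : 0 < eps0 by rewrite /eps0; nra.
split.
- move=> y [y0 yext]; apply: Rnot_lt_le => yeps.
  (* The lower bound is stated for rational palettes, so a rational [m] is chosen in the gap;
     membership of [y] in [g_set] covers every larger value. *)
  have [|P [Q [Q0 [h1 h2]]]] := @rational_between (k + y) (k + eps0); first lra.
  have Q0' : 0 < INR Q by apply: lt_0_INR; apply/ltP.
  pose eps := INR P / INR Q - k.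
  have kE : k + eps = INR P / INR Q by rewrite /eps; ring.
  have ext : ext_property k 6 eps by apply: yext; rewrite /eps; lra.
  have PQ : INR P = INR P / INR Q * INR Q by field; lra.
  have QP : (Q <= P)%N by apply/leP/INR_le; rewrite PQ; nra.
  have P0 : 0 < INR P by rewrite PQ; nra.
  have : k + INR Q / INR P <= INR P / INR Q.
    case: hrange => [k_2|/(rational_odd_form hk)[q [r [qr rq kqr]]]].
      by move: kE ext; rewrite k_2; apply: edge_gadget_bound.
    exact: odd_gadget_bound qr rq kqr Q0 QP kE ext.
  (* As [m < k + eps0], the product [m * (m - k)] is below [eps0 * (k + eps0) = 1], contradicting
     [k + 1 / m <= m]. *)
  have : INR Q / INR P * (INR P / INR Q) = 1 by field; lra.
  move: (INR Q / INR P) (INR P / INR Q) h1 h2 => a m h1 h2 am h.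
  nra.
(* The infimum is attained: [eps * (k + eps)] increases with [eps], so [eps0] itself lies in the
   set. *)
- move=> z hz; apply: hz; split; first lra.
  move=> eps heps; apply: ext_property_large => //; nra.
Qed.
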